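(* The following identities hold: \begin{align*} \sum_{n\ge0}\overline{S_9}(6n+1)q^n&=2\frac{f_2^6f_3^4}{f_1^8f_6^2},\\ \sum_{n\ge0}\overline{S_9}(6n+3)q^n&=4\frac{f_2^5f_3f_6}{f_1^7},\\ \sum_{n\ge0}\overline{S_9}(6n+5)q^n&=8\frac{f_2^4f_6^4}{f_1^6f_3^2}. \end{align*}
   Context: For $|q|<1$ and a positive integer $k$, write $f_k=\prod_{j\ge1}(1-q^{kj})$. The function $\overline{S_9}(n)$ (number of $9$-Schur overpartitions of $n$) is defined by $\sum_{n\ge0}\overline{S_9}(n)q^n=\prod_{n\ge1}\frac{(1+q^{2n-1})(1-q^{9(2n-1)})}{(1+q^{9(2n-1)})(1-q^{2n-1})}=\frac{f_2^3f_9^2f_{36}}{f_1^2f_4f_{18}^3}$. *)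

(* Defs.v *)
From HB Require Import structures.
From mathcomp Require Import all_boot all_order all_algebra.
From mathcomp Require Import all_classical all_reals all_analysis.
From mathcomp Require Import complex.

Set Implicit Arguments.
Unset Strict Implicit.
Unset Printing Implicit Defensive.

Import Order.TTheory GRing.Theory Num.Theory.
Import numFieldNormedType.Exports.

Local Open Scope classical_set_scope.
Local Open Scope complex_scope.
Local Open Scope ring_scope.

(* The modulus topology on R[i] is only registered on its alias R[i]^o, hence
   the casts. *)
Definition has_sum (R : realType) (a : nat -> R[i]) (s : R[i]) : Prop :=
  series a @ \oo --> (s : R[i]^o).

(* \prod_(j >= 1) u j; the index starts at 1. *)
Definition infprod (R : realType) (u : nat -> R[i]) : R[i] :=
  lim ((fun N => \prod_(1 <= j < N.+1) u j : R[i]^o) @ \oo).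

Definition f_ (R : realType) (k : nat) (q : R[i]) : R[i] :=
  infprod (fun j => 1 - q ^+ (k * j)).

Definition schur9_product (R : realType) (q : R[i]) : R[i] :=
  infprod (fun n =>
    ((1 + q ^+ (2 * n - 1)) * (1 - q ^+ (9 * (2 * n - 1)))) /
    ((1 + q ^+ (9 * (2 * n - 1))) * (1 - q ^+ (2 * n - 1)))).

Definition is_schur9_counting (R : realType) (S : nat -> nat) : Prop :=
  forall q : R[i], `|q| < 1 ->
    has_sum (fun n => (S n)%:R * q ^+ n) (schur9_product q).

(* S9bar R n is the number of 9-Schur overpartitions of n: the coefficient
   sequence determined by the generating function.  The real field R only serves
   to express convergence. *)
Definition S9bar (R : realType) : nat -> nat :=
  get [set S : nat -> nat | is_schur9_counting R S].

(* Main.v *)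
Require Import Defs.
From mathcomp Require Import all_boot all_order all_algebra.
From mathcomp Require Import all_classical all_reals all_analysis.
From mathcomp Require Import complex ring lra zify.

Set Implicit Arguments.
Unset Strict Implicit.
Unset Printing Implicit Defensive.

Import Order.TTheory GRing.Theory Num.Theory.
Import numFieldNormedType.Exports.

Local Open Scope classical_set_scope.
Local Open Scope complex_scope.
Local Open Scope ring_scope.

(* Write phi(-q) = f_1^2/f_2, psi(q) = f_2^2/f_1, u(q) = f_2 f_3^3/(f_1 f_6^3) and
   a(q) = f_2^3/(f_1 f_3 f_6).  The Jacobi triple product gives the 3-dissections
   phi(-q) = phi(-q^9) (1 - 2q/u(q^3)) and psi(q) = psi(q^9) (u(q^3) + q), and
   multiplying each over q, wq, w^2q with w a primitive cube root of unity gives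
     1 - 8q/u(q)^3 = phi(-q)^4/phi(-q^3)^4,  u(q)^3 + q = psi(q)^4/psi(q^3)^4.
   As phi(q) phi(-q) = phi(-q^2)^2, the first dissection also yields
   u(Q) - u(-Q) = 2Q/u(Q^2), while u(Q) u(-Q) = u(Q^2).  Hence (u(Q) + u(-Q))^2
   equals 4 a(Q^2)^2, and u(Q) + u(-Q) = 2 a(Q^2) by continuity from Q = 0.
   The generating function is, with v = u(-z^3) and w = u(z^6),
     (1 + 2z/v) / (1 - 2z^2/w)
       = (1 + 2z/v) (1 + 2z^2/w + 4z^4/w^2) / (1 - 8z^6/w^3),
   whose parts of exponent 1, 3, 5 mod 6 only involve u(z^3) + u(-z^3), w and z^6. *)

(* A record rather than a definition: [f @ F --> l] unfolds to a product, which
   makes [apply] miscount the arguments of lemmas about limits. *)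
Record tends (R : realType) T (F : set_system T) (f : T -> R[i]) (l : R[i]) : Prop :=
  Tends { tends_cvg : (f : T -> R[i]^o) @ F --> (l : R[i]^o) }.

Definition sums (R : realType) (a : nat -> R[i]) (s : R[i]) := tends \oo (series a) s.

Definition has_prod (R : realType) (v : nat -> R[i]) (P : R[i]) :=
  tends \oo (fun n => \prod_(0 <= j < n) v j) P.

Lemma has_sumP (R : realType) (a : nat -> R[i]) s : has_sum a s <-> sums a s.
Proof. by split=> [|[]]. Qed.

Section Limits.
Variable R : realType.
Implicit Types (z l m : R[i]) (b : nat -> R).

Lemma norm_real z : exists2 r : R, 0 <= r & `|z| = r%:C.
Proof. by rewrite normc_def; eexists; last by []; exact: sqrtr_ge0. Qed.

Section Filters.
Variables (T : Type) (F : set_system T).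
Implicit Types (f g : T -> R[i]).

Lemma tendsP {FF : Filter F} f l :
  tends F f l <-> forall e : R, 0 < e -> \forall x \near F, `|l - f x| < e%:C.
Proof.
split=> [[/cvgrPdist_lt /= H] e e0|H]; first by apply: H; rewrite ltcR.
split; apply/cvgrPdist_lt => /= e e0.
have eE : (complex.Re e)%:C = e by apply: RRe_real; exact: gtr0_real.
by rewrite -eE; apply: H; rewrite -ltcR eE.
Qed.

Lemma tends_cst {FF : Filter F} l : tends F (fun=> l) l.
Proof. by split; exact: cvg_cst. Qed.

Lemma tends_unique {FF : ProperFilter F} f l m : tends F f l -> tends F f m -> l = m.
Proof. by move=> [fl] [fm]; exact: (cvg_unique (@norm_hausdorff _ (R[i]^o))) fl fm. Qed.

Lemma tends_near {FF : Filter F} f g l :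
  (\forall x \near F, f x = g x) -> tends F f l -> tends F g l.
Proof.
move=> fg [fl]; split; apply: cvg_trans fl; apply: near_eq_cvg.
by apply: filterS fg => x ->.
Qed.

Lemma tends_ext {FF : Filter F} f g l : f =1 g -> tends F f l -> tends F g l.
Proof. by move=> fg; apply: tends_near; apply: nearW. Qed.

Lemma tendsD {FF : Filter F} f g l m :
  tends F f l -> tends F g m -> tends F (fun x => f x + g x) (l + m).
Proof. by move=> [hf] [hg]; split; exact: (cvgD hf hg). Qed.

Lemma tendsN {FF : Filter F} f l : tends F f l -> tends F (fun x => - f x) (- l).
Proof. by move=> [hf]; split; exact: (cvgN hf). Qed.

Lemma tendsB {FF : Filter F} f g l m :
  tends F f l -> tends F g m -> tends F (fun x => f x - g x) (l - m).
Proof. by move=> hf hg; apply: tendsD => //; exact: tendsN. Qed.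

Lemma tendsM {FF : Filter F} f g l m :
  tends F f l -> tends F g m -> tends F (fun x => f x * g x) (l * m).
Proof. by move=> [hf] [hg]; split; exact: (cvgM hf hg). Qed.

Lemma tendsX {FF : Filter F} f l n :
  tends F f l -> tends F (fun x => f x ^+ n) (l ^+ n).
Proof.
move=> hf; elim: n => [|n IH]; first exact: tends_cst.
rewrite exprS; apply: tends_ext (tendsM hf IH) => x; exact/esym/exprS.
Qed.

Lemma tendsV {FF : Filter F} f l :
  l != 0 -> tends F f l -> tends F (fun x => (f x)^-1) l^-1.
Proof. by move=> l0 [hf]; split; exact: (cvgV l0 hf). Qed.

Lemma tends_sum {FF : Filter F} (f : nat -> T -> R[i]) (l : nat -> R[i]) n :
  (forall k, tends F (f k) (l k)) ->
  tends F (fun x => \sum_(0 <= k < n) f k x) (\sum_(0 <= k < n) l k).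
Proof.
move=> hf; elim: n => [|n IH].
  by rewrite big_geq//; apply: tends_ext (tends_cst 0) => x; rewrite big_geq.
rewrite big_nat_recr//=; apply: tends_ext (tendsD IH (hf n)) => x.
by rewrite big_nat_recr.
Qed.

Lemma tends_prod {FF : Filter F} (f : nat -> T -> R[i]) (l : nat -> R[i]) n :
  (forall k, tends F (f k) (l k)) ->
  tends F (fun x => \prod_(0 <= k < n) f k x) (\prod_(0 <= k < n) l k).
Proof.
move=> hf; elim: n => [|n IH].
  by rewrite big_geq//; apply: tends_ext (tends_cst 1) => x; rewrite big_geq.
rewrite big_nat_recr//=; apply: tends_ext (tendsM IH (hf n)) => x.
by rewrite big_nat_recr.
Qed.

Lemma tends_le {FF : ProperFilter F} f l (B : R) :
  tends F f l -> (\forall x \near F, `|f x| <= B%:C) -> `|l| <= B%:C.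
Proof.
move=> /tendsP fl fB; have [r r0 lr] := norm_real l; rewrite lr lecR.
rewrite leNgt; apply/negP => Br.
have e0 : 0 < r - B by rewrite subr_gt0.
near F => x.
have h1 : `|l - f x| < (r - B)%:C by near: x; exact: fl.
have h2 : `|f x| <= B%:C by near: x.
have : `|l| < (r - B)%:C + B%:C.
  rewrite -[X in `|X|](subrK (f x)).
  by apply: le_lt_trans (ler_normD _ _) _; exact: ltr_leD.
by rewrite -rmorphD subrK lr ltxx.
Unshelve. all: by end_near. Qed.

Lemma tends_Re {FF : Filter F} f l :
  tends F f l -> (fun x => complex.Re (f x)) @ F --> complex.Re l.
Proof.
move=> /tendsP fl; apply/cvgrPdist_lt => /= e e0.
apply: filterS (fl _ e0) => x /(le_lt_trans (normc_ge_Re _)).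
by rewrite ltcR raddfB.
Qed.

End Filters.

Lemma tends_comp (u : nat -> R[i]) l (h : nat -> nat) k :
  (forall n, (n <= h n + k)%N) -> tends \oo u l -> tends \oo (u \o h) l.
Proof.
move=> hn [ul]; split; apply: (cvg_comp _ _ _ ul).
move=> A [N _ NA]; exists (N + k)%N => //= n /= Nn; apply: NA => /=.
by have := hn n; lia.
Qed.

Lemma has_prod_unique (a : nat -> R[i]) l m : has_prod a l -> has_prod a m -> l = m.
Proof. exact: tends_unique. Qed.

Lemma sums_exists (a : nat -> R[i]) b : cvgn (series b) ->
  (forall k, `|a k| <= (b k)%:C) -> exists s, sums a s.
Proof.
move=> cb ab.
have part (c : nat -> R) : (forall k, `|c k| <= b k) -> cvgn (series c).
  move=> cle; apply: (@normed_cvg R R^o).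
  by apply: (series_le_cvg _ _ _ cb) => n //=; exact: le_trans (cle n).
have /cvg_ex[sr hr] : cvgn (series (fun k => complex.Re (a k))).
  by apply: part => k; rewrite -lecR; exact: le_trans (normc_ge_Re _) _.
have /cvg_ex[si hi] : cvgn (series (fun k => complex.Im (a k))).
  apply: part => k; rewrite -lecR; apply: le_trans (ab k).
  have := normc_ge_Re ('i%C * a k); rewrite normrM.
  suff -> : `|'i%C| = 1 :> R[i].
    by rewrite mul1r mulrC ReiNIm normrN.
  by rewrite normc_def /= expr0n /= expr1n add0r sqrtr1.
exists (sr +i* si); apply/tendsP => e e0.
move/cvgrPdist_lt : hr => /(_ (e / 2)); rewrite divr_gt0// => /(_ isT) hr.
move/cvgrPdist_lt : hi => /(_ (e / 2)); rewrite divr_gt0// => /(_ isT) hi.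
have aE n : series a n = series (fun k => complex.Re (a k)) n +i*
                         series (fun k => complex.Im (a k)) n.
  rewrite /series /=; elim: n => [|n IH]; first by rewrite !big_geq.
  by rewrite !big_nat_recr//= IH; case: (a n).
near=> n; rewrite aE.
have hx : `|sr - series (fun k => complex.Re (a k)) n| < e / 2.
  by near: n; exact: hr.
have hy : `|si - series (fun k => complex.Im (a k)) n| < e / 2.
  by near: n; exact: hi.
move: hx hy; set x := series _ n; set y := series _ n => hx hy.
have -> : sr +i* si - x +i* y = (sr - x)%:C + 'i%C * (si - y)%:C.
  by rewrite [LHS]complexE.
apply: le_lt_trans (ler_normD _ _) _; rewrite normrM !normc_def /= !expr0n /=.
rewrite expr1n add0r !addr0 !sqrtr_sqr sqrtr1 mul1r -rmorphD ltcR.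
by rewrite [e]splitr ltrD.
Unshelve. all: by end_near. Qed.

Lemma series_tail b (e : R) : cvgn (series b) -> 0 < e ->
  exists N, forall n, (N <= n)%N -> \sum_(N <= k < n) b k <= e.
Proof.
move=> /cvg_ex[l /cvgrPdist_lt /= H] e0.
have [|N _ NH] := H (e / 2); first by rewrite divr_gt0.
exists N => n Nn.
have <- := sub_series_geq b Nn.
have := NH _ Nn; have := NH N (leqnn _); set x := series b n; set y := series b N.
rewrite !ltr_norml => /andP[h1 h2] /andP[h3 h4]; lra.
Qed.

Lemma sums_tail (a : nat -> R[i]) b s N (e : R) : sums a s ->
  (forall k, `|a k| <= (b k)%:C) ->
  (forall n, (N <= n)%N -> \sum_(N <= k < n) b k <= e) ->
  `|s - series a N| <= e%:C.
Proof.
move=> hs ab be.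
apply: (tends_le (tendsB hs (@tends_cst _ _ _ (series a N)))).
near=> n; have Nn : (N <= n)%N by near: n; exists N.
rewrite (sub_series_geq a Nn).
apply: le_trans (ler_norm_sum _ _ _) _.
apply: (@le_trans _ _ (\sum_(N <= k < n) (b k)%:C)).
  by rewrite !big_seq; apply: ler_sum.
by rewrite -rmorph_sum lecR; exact: be.
Unshelve. all: by end_near. Qed.

Lemma tannery T (F : set_system T) {FF : ProperFilter F}
    (a : T -> nat -> R[i]) (s : T -> R[i]) b (l : nat -> R[i]) :
  cvgn (series b) ->
  (\forall x \near F, forall k, `|a x k| <= (b k)%:C) ->
  (forall k, tends F (a^~ k) (l k)) ->
  (\forall x \near F, sums (a x) (s x)) ->
  exists2 S, sums l S & tends F s S.
Proof.
move=> cb ab al as_.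
have lb k : `|l k| <= (b k)%:C.
  by apply: tends_le (al k) _; apply: filterS ab => x; apply.
have [S hS] := sums_exists cb lb; exists S => //.
apply/tendsP => e e0.
have [|N hN] := @series_tail b (e / 4) cb; first by rewrite divr_gt0.
have hfin : tends F (fun x => series (a x) N) (series l N).
  exact: tends_sum.
move/tendsP : hfin => /(_ (e / 4)); rewrite divr_gt0// => /(_ isT) hfin.
near=> x.
have h1 : `|s x - series (a x) N| <= (e / 4)%:C.
  by apply: (@sums_tail (a x) b) => //; near: x.
have h2 : `|S - series l N| <= (e / 4)%:C by exact: (@sums_tail l b).
have h3 : `|series l N - series (a x) N| < (e / 4)%:C by near: x.
have : `|S - s x| <= (e / 4)%:C + (e / 4)%:C + (e / 4)%:C.
  have -> : S - s x = (S - series l N) + (series l N - series (a x) N)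
     - (s x - series (a x) N) by ring.
  apply: le_trans (ler_normB _ _) _; apply: lerD => //.
  by apply: le_trans (ler_normD _ _) _; apply: lerD => //; exact: ltW.
rewrite -!rmorphD => h.
by apply: le_lt_trans h _; rewrite ltcR; lra.
Unshelve. all: by end_near. Qed.

Lemma prod_bound b : cvgn (series b) -> (forall k, 0 <= b k) ->
  exists2 B : R, 0 < B & forall (v : nat -> R[i]) n,
    (forall j, `|v j - 1| <= (b j)%:C) -> `|\prod_(0 <= j < n) v j| <= B%:C.
Proof.
move=> cb b0; exists (expR (limn (series b))); first exact: expR_gt0.
move=> v n vb.
apply: (@le_trans _ _ (expR (series b n))%:C); last first.
  rewrite lecR ler_expR; apply: nondecreasing_cvgn_le => //.
  by apply/nondecreasing_seqP => k; rewrite -subr_ge0 seriesSB.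
elim: n => [|n IH]; first by rewrite !big_geq// /series /= big_geq// expR0 normr1.
rewrite big_nat_recr//= /series /= big_nat_recr//= expRD rmorphM normrM.
apply: ler_pM => //; apply: le_trans (_ : (1 + b n)%:C <= _); last first.
  by rewrite lecR; exact: expR_ge1Dx.
rewrite -[X in `|X|](subrK 1) rmorphD addrC.
by apply: le_trans (ler_normD _ _) _; rewrite normr1 lerD2l.
Qed.

Lemma prod_telescope (v : nat -> R[i]) n : \prod_(0 <= j < n) v j =
  1 + series (fun k => (\prod_(0 <= j < k) v j) * (v k - 1)) n.
Proof.
elim: n => [|n IH]; first by rewrite /series /= !big_geq// addr0.
rewrite {1}big_nat_recr//= /series /= big_nat_recr//= addrA -IH.
ring.
Qed.

Lemma has_prod_sums (v : nat -> R[i]) P : has_prod v P <->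
  sums (fun k => (\prod_(0 <= j < k) v j) * (v k - 1)) (P - 1).
Proof.
split=> h.
  apply: tends_ext (tendsB h (tends_cst 1)) => n /=.
  by rewrite prod_telescope; ring.
rewrite -[P](subrK 1) addrC; apply: tends_ext (tendsD (tends_cst 1) h) => n /=.
by rewrite prod_telescope.
Qed.

Lemma bound_ge0 (v : nat -> R[i]) b : (forall j, `|v j| <= (b j)%:C) ->
  forall k, 0 <= b k.
Proof. by move=> vb k; rewrite -lecR; apply: le_trans (normr_ge0 _) (vb k). Qed.

Lemma has_prod_exists (v : nat -> R[i]) b : cvgn (series b) ->
  (forall j, `|v j - 1| <= (b j)%:C) -> exists P, has_prod v P.
Proof.
move=> cb vb; have b0 := bound_ge0 vb.
have [B B0 hB] := prod_bound cb b0.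
have [|k|s hs] := @sums_exists
  (fun k => (\prod_(0 <= j < k) v j) * (v k - 1)) (B *: b).
- exact: is_cvg_seriesZ.
- by rewrite normrM [(B *: b) k]/(B * b k) rmorphM; apply: ler_pM => //; exact: hB.
by exists (s + 1); apply/has_prod_sums; rewrite addrK.
Qed.

Lemma tannery_prod T (F : set_system T) {FF : ProperFilter F}
    (v : T -> nat -> R[i]) (P : T -> R[i]) b (l : nat -> R[i]) :
  cvgn (series b) ->
  (forall x j, `|v x j - 1| <= (b j)%:C) ->
  (forall k, tends F (v^~ k) (l k)) ->
  (forall x, has_prod (v x) (P x)) ->
  exists2 L, has_prod l L & tends F P L.
Proof.
move=> cb vb vl vP.
have [x _] := filter_ex (filterT : F setT); have b0 := bound_ge0 (vb x).
have [B B0 hB] := prod_bound cb b0.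
have [||k||S hS1 hS2] := @tannery T F _
  (fun x k => (\prod_(0 <= j < k) v x j) * (v x k - 1)) (fun x => P x - 1)
  (B *: b) (fun k => (\prod_(0 <= j < k) l j) * (l k - 1)).
- exact: is_cvg_seriesZ.
- apply: nearW => y k; rewrite normrM [(B *: b) k]/(B * b k) rmorphM.
  by apply: ler_pM => //; exact: hB.
- apply: tendsM; first exact: tends_prod.
  by apply: tendsB => //; exact: tends_cst.
- by apply: nearW => y; apply/has_prod_sums.
exists (S + 1); first by apply/has_prod_sums; rewrite addrK.
by apply: tends_ext (tendsD hS2 (tends_cst 1)) => y; rewrite subrK.
Qed.

Lemma has_prodM (u v : nat -> R[i]) P Q :
  has_prod u P -> has_prod v Q -> has_prod (fun j => u j * v j) (P * Q).
Proof. by move=> hu hv; apply: tends_ext (tendsM hu hv) => n; rewrite big_split. Qed.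

Lemma has_prodV (u : nat -> R[i]) P :
  P != 0 -> has_prod u P -> has_prod (fun j => (u j)^-1) P^-1.
Proof. by move=> P0 hu; apply: tends_ext (tendsV P0 hu) => n; rewrite prodfV. Qed.

Lemma has_prod_neq0 (v : nat -> R[i]) P b : cvgn (series b) ->
  (forall j, v j != 0) -> (forall j, `|(v j)^-1 - 1| <= (b j)%:C) ->
  has_prod v P -> P != 0.
Proof.
move=> cb v0 vb hP; have [Q hQ] := has_prod_exists cb vb.
have : P * Q = 1.
  apply: tends_unique (has_prodM hP hQ) _; apply: tends_ext (tends_cst 1) => n.
  by rewrite big1// => j _; rewrite divff.
by move=> PQ; apply/eqP => P0; move: PQ; rewrite P0 mul0r => /esym/eqP; rewrite oner_eq0.
Qed.

Lemma geometric_cvg (r c : R) : 0 <= r < 1 -> cvgn (series (fun k => c * r ^+ k)).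
Proof.
move=> /andP[r0 r1]; apply: is_cvg_geometric_series.
by rewrite ger0_norm.
Qed.

End Limits.

Section InfiniteProducts.
Variable R : realType.
Implicit Types (a p q w z : R[i]).

Definition qp a p : R[i] := infprod (fun j => 1 - a * p ^+ j.-1).

Lemma infprodE (u : nat -> R[i]) P : has_prod (fun j => u j.+1) P -> infprod u = P.
Proof.
move=> [hP]; apply: (cvg_lim (@norm_hausdorff _ (R[i]^o))).
by under eq_fun do rewrite big_add1.
Qed.

Lemma norm_lt1 z : `|z| < 1 -> exists2 r : R, 0 <= r < 1 & `|z| = r%:C.
Proof.
have [r r0 ->] := norm_real z => r1; exists r => //.
by rewrite r0 -ltcR.
Qed.

Lemma qp_factor_bound a p (A r : R) j : `|a| <= A%:C -> `|p| <= r%:C ->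
  `|1 - a * p ^+ j - 1| <= (A * r ^+ j)%:C.
Proof.
move=> aA pr; rewrite addrC addKr normrN normrM normrX rmorphM rmorphXn.
by apply: ler_pM => //; apply: lerXn2r; rewrite // nnegrE; exact: le_trans pr.
Qed.

Lemma qpP a p : `|p| < 1 -> has_prod (fun j => 1 - a * p ^+ j) (qp a p).
Proof.
move=> /norm_lt1[r r01 pr]; have [A _ aA] := norm_real a.
have [||P hP] := @has_prod_exists R (fun j => 1 - a * p ^+ j) (fun j => A * r ^+ j).
- exact: geometric_cvg.
- by move=> j; apply: qp_factor_bound; rewrite ?aA ?pr.
by rewrite /qp (infprodE (u := fun j => 1 - a * p ^+ j.-1) hP).
Qed.

Lemma qpE a p P : has_prod (fun j => 1 - a * p ^+ j) P -> qp a p = P.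
Proof. exact: (infprodE (u := fun j => 1 - a * p ^+ j.-1)). Qed.

Lemma qp_tends T (F : set_system T) {FF : ProperFilter F} (a p : T -> R[i])
    (r : R) a0 p0 : 0 <= r < 1 ->
  (forall x, `|a x| <= 1) -> (forall x, `|p x| <= r%:C) ->
  tends F a a0 -> tends F p p0 -> tends F (fun x => qp (a x) (p x)) (qp a0 p0).
Proof.
move=> r01 a1 pr ha hp.
have [||||L hL hF] := @tannery_prod R T F _ (fun x j => 1 - a x * p x ^+ j)
   (fun x => qp (a x) (p x)) (fun j => 1 * r ^+ j) (fun j => 1 - a0 * p0 ^+ j).
- exact: geometric_cvg.
- by move=> x j; apply: qp_factor_bound.
- by move=> j; apply: tendsB; [exact: tends_cst|apply: tendsM => //; exact: tendsX].
- by move=> x; apply: qpP; apply: le_lt_trans (pr x) _; rewrite ltcR; case/andP: r01.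
by rewrite (qpE hL).
Qed.

Lemma qp_factorV_bound a p (A r : R) j : A < 1 -> r < 1 -> `|a| = A%:C -> `|p| = r%:C ->
  1 - a * p ^+ j != 0 /\ `|(1 - a * p ^+ j)^-1 - 1| <= ((1 - A)^-1 * r ^+ j)%:C.
Proof.
move=> A1 r1 aA pr.
have A0 : 0 <= A by rewrite -ler0c -aA.
have r0 : 0 <= r by rewrite -ler0c -pr.
have ap : `|a * p ^+ j| <= A%:C.
  rewrite normrM aA -[leRHS]mulr1; apply: ler_pM => //; first by rewrite ler0c.
  by rewrite normrX exprn_ile1 // pr lecR ltW.
have lb : (1 - A)%:C <= `|1 - a * p ^+ j|.
  rewrite rmorphB lerBlDr; have := ler_normD (1 - a * p ^+ j) (a * p ^+ j).
  by rewrite subrK normr1 => /le_trans; apply; rewrite lerD2l.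
have nz : 1 - a * p ^+ j != 0.
  by rewrite -normr_gt0; apply: lt_le_trans lb; rewrite ltcR subr_gt0.
split=> //; have -> : (1 - a * p ^+ j)^-1 - 1 = (1 - a * p ^+ j)^-1 * (a * p ^+ j).
  by apply: (mulfI nz); rewrite mulrBr mulrA divff// mul1r mulr1; ring.
rewrite normrM rmorphM; apply: ler_pM => //.
  rewrite normfV fmorphV /= lef_pV2 ?posrE ?normr_gt0 ?ltcR ?subr_gt0//.
rewrite normrM normrX pr aA rmorphXn; apply: ler_piMl; last by rewrite lecR ltW.
by rewrite exprn_ge0// ler0c.
Qed.

Lemma qp_neq0 a p : `|a| < 1 -> `|p| < 1 -> qp a p != 0.
Proof.
move=> a1 p1; have [A /andP[A0 A1] aA] := norm_lt1 a1.
have [r /andP[r0 r1] pr] := norm_lt1 p1.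
have h j := qp_factorV_bound j A1 r1 aA pr.
apply: (has_prod_neq0 (b := fun j => (1 - A)^-1 * r ^+ j) _ _ _ (qpP a p1)).
- by apply: geometric_cvg; rewrite r0.
- by move=> j; case: (h j).
- by move=> j; case: (h j).
Qed.

Lemma norm_expr_lt1 q n : (0 < n)%N -> `|q| < 1 -> `|q ^+ n| < 1.
Proof. by move=> n0 q1; rewrite normrX exprn_ilt1// -lt0n. Qed.

Lemma qpM a p : `|p| < 1 -> qp a p * qp (- a) p = qp (a ^+ 2) (p ^+ 2).
Proof.
move=> p1; apply/esym/qpE; apply: tends_ext (has_prodM (qpP a p1) (qpP (- a) p1)).
by move=> n; apply: eq_bigr => j _; rewrite -exprM mulnC exprM; ring.
Qed.

Lemma qpM3 a p w : w ^+ 2 + w + 1 = 0 -> `|p| < 1 ->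
  qp a p * qp (w * a) p * qp (w ^+ 2 * a) p = qp (a ^+ 3) (p ^+ 3).
Proof.
move=> w3 p1; apply/esym/qpE.
apply: tends_ext (has_prodM (has_prodM (qpP a p1) (qpP (w * a) p1)) (qpP (w ^+ 2 * a) p1)).
move=> n; apply: eq_bigr => j _; rewrite -exprM mulnC exprM.
have -> : w ^+ 2 = - w - 1 by apply/eqP; rewrite -subr_eq0 -w3; apply/eqP; ring.
set x := p ^+ j; apply/eqP; rewrite -subr_eq0.
have -> : (1 - a * x) * (1 - w * a * x) * (1 - (- w - 1) * a * x) -
   (1 - a ^+ 3 * x ^+ 3) = (w ^+ 2 + w + 1) * (a * x) ^+ 2 * (a * x - 1) by ring.
by rewrite w3 !mul0r.
Qed.

Lemma prod_nat2 (g : nat -> R[i]) n :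
  \prod_(0 <= j < 2 * n) g j = \prod_(0 <= j < n) (g (2 * j)%N * g (2 * j).+1).
Proof.
elim: n => [|n IH]; first by rewrite !big_geq.
by rewrite mulnS !addSn add0n !big_nat_recr//= IH !mulrA.
Qed.

Lemma prod_nat3 (g : nat -> R[i]) n : \prod_(0 <= j < 3 * n) g j =
  \prod_(0 <= j < n) (g (3 * j)%N * g (3 * j).+1 * g (3 * j).+2).
Proof.
elim: n => [|n IH]; first by rewrite !big_geq.
by rewrite mulnS !addSn add0n !big_nat_recr//= IH !mulrA.
Qed.

Lemma qp_split2 a p : `|p| < 1 -> qp a p = qp a (p ^+ 2) * qp (a * p) (p ^+ 2).
Proof.
move=> p1; have p21 := norm_expr_lt1 (isT : 0 < 2)%N p1.
have h := tends_comp (h := fun n => (2 * n)%N) (k := 0) _ (qpP a p1).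
apply: tends_unique (h _) _ => [n|]; first lia.
apply: tends_ext (has_prodM (qpP a p21) (qpP (a * p) p21)) => n /=.
rewrite prod_nat2; apply: eq_bigr => j _.
by rewrite -exprM (exprS p (2 * j)) mulrA.
Qed.

Lemma qp_split3 a p : `|p| < 1 ->
  qp a p = qp a (p ^+ 3) * qp (a * p) (p ^+ 3) * qp (a * p ^+ 2) (p ^+ 3).
Proof.
move=> p1; have p31 := norm_expr_lt1 (isT : 0 < 3)%N p1.
have h := tends_comp (h := fun n => (3 * n)%N) (k := 0) _ (qpP a p1).
apply: tends_unique (h _) _ => [n|]; first lia.
apply: tends_ext (has_prodM (has_prodM (qpP a p31) (qpP (a * p) p31))
  (qpP (a * p ^+ 2) p31)) => n /=.
rewrite prod_nat3; apply: eq_bigr => j _.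
by rewrite -[in LHS]exprM (exprS p (3 * j).+1) (exprS p (3 * j)) expr2 !mulrA.
Qed.

Lemma f_qp k q : f_ k q = qp (q ^+ k) (q ^+ k).
Proof.
rewrite /f_ /qp /infprod; under eq_fun do rewrite big_add1.
under [in RHS]eq_fun do rewrite big_add1.
suff -> : (fun n => \prod_(0 <= j < n) (1 - q ^+ (k * j.+1))) =
          (fun n => \prod_(0 <= j < n) (1 - q ^+ k * (q ^+ k) ^+ j.+1.-1)) by [].
apply/funext => n; apply: eq_bigr => j _.
by rewrite -exprS -exprM.
Qed.

Lemma f_neq0 k q : (0 < k)%N -> `|q| < 1 -> f_ k q != 0.
Proof. by move=> k0 q1; rewrite f_qp qp_neq0// norm_expr_lt1. Qed.

Lemma f_exprM k m q : f_ k (q ^+ m) = f_ (m * k) q.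
Proof. by rewrite !f_qp -exprM. Qed.

Lemma f_tends T (F : set_system T) {FF : ProperFilter F} (x : T -> R[i]) (r : R) q k :
  (0 < k)%N -> 0 <= r < 1 -> (forall t, `|x t| <= r%:C) -> tends F x q ->
  tends F (fun t => f_ k (x t)) (f_ k q).
Proof.
move=> k0 /andP[r0 r1] xr hx; rewrite f_qp.
have rC1 : r%:C <= 1 :> R[i] by rewrite lecR ltW.
have xk t : `|x t ^+ k| <= r%:C.
  rewrite normrX -(prednK k0) exprS; apply: le_trans (xr t); apply: ler_piMr => //.
  by apply: exprn_ile1 => //; exact: le_trans (xr t) rC1.
apply: (tends_ext (f := fun t => qp (x t ^+ k) (x t ^+ k))) => [t|].
  by rewrite f_qp.
apply: (qp_tends (r := r)); rewrite ?r0//; try exact: tendsX.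
by move=> t; exact: le_trans (xk t) rC1.
Qed.

Lemma f0 k : (0 < k)%N -> f_ k (0 : R[i]) = 1.
Proof.
move=> k0; rewrite f_qp; apply: qpE; apply: tends_ext (tends_cst 1) => n.
by rewrite big1// => j _; rewrite expr0n -[k == 0]negbK -lt0n k0 mul0r subr0.
Qed.

End InfiniteProducts.

Section JacobiTripleProduct.
Variable R : realType.
Implicit Types (a b p q x : R[i]).

Fixpoint qbin p N k : R[i] :=
  match N, k with
  | _, 0 => 1
  | 0, _.+1 => 0
  | N'.+1, k'.+1 => qbin p N' k'.+1 + p ^+ (N' - k') * qbin p N' k'
  end.

Arguments qbin : simpl never.

Lemma qbin0 p N : qbin p N 0 = 1. Proof. by case: N. Qed.

Lemma qbinS p N k :
  qbin p N.+1 k.+1 = qbin p N k.+1 + p ^+ (N - k) * qbin p N k.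
Proof. by []. Qed.

Lemma qbin_small p N k : (N < k)%N -> qbin p N k = 0.
Proof.
elim: N k => [|N IH] [|k] // Nk.
by rewrite qbinS !IH ?mulr0 ?addr0//; lia.
Qed.

Lemma qbinn p N : qbin p N N = 1.
Proof. by elim: N => // N IH; rewrite qbinS qbin_small// subnn IH mul1r add0r. Qed.

Lemma sum_qbinS p N (t : nat -> R[i]) :
  \sum_(0 <= i < N.+2) qbin p N.+1 i * t i =
  \sum_(0 <= i < N.+1) qbin p N i * (t i + p ^+ (N - i) * t i.+1).
Proof.
under [RHS]eq_bigr do rewrite mulrDr.
rewrite big_split /= big_nat_recl// qbin0.
have -> : \sum_(0 <= i < N.+1) qbin p N i * t i =
  t 0 + \sum_(0 <= i < N.+1) qbin p N i.+1 * t i.+1.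
  rewrite big_nat_recl// qbin0 mul1r; congr (_ + _).
  by rewrite [in RHS]big_nat_recr//= qbin_small// mul0r addr0.
rewrite mul1r -addrA -big_split /=; congr (_ + _); apply: eq_bigr => i _.
by rewrite qbinS; ring.
Qed.

Definition theta a b k : R[i] := a ^+ 'C(k.+1, 2) * b ^+ 'C(k, 2).

Lemma theta0 a b : theta a b 0 = 1.
Proof. by rewrite /theta !bin0n !expr0 mulr1. Qed.

Lemma bin2S k : 'C(k.+1, 2) = ('C(k, 2) + k)%N.
Proof. by rewrite binS bin1 addnC. Qed.

Lemma thetaS a b k : theta a b k.+1 = theta a b k * a * (a * b) ^+ k.
Proof.
rewrite /theta (bin2S k.+1) {2}(bin2S k) !exprD exprS exprMn.
ring.
Qed.

Lemma thetaE a b k : theta a b k = a ^+ k * (a * b) ^+ 'C(k, 2).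
Proof.
by rewrite /theta bin2S exprD exprMn mulrA [a ^+ _ * a ^+ k]mulrC.
Qed.

(* The term of index [i - n] of the bilateral theta series in [a] and [b]. *)
Definition shifted_theta a b n i :=
  if (n <= i)%N then theta a b (i - n) else theta b a (n - i).

Lemma shifted_thetaS a b m n i : (i <= m + n)%N ->
  (a * b) ^+ (m + n - i) * shifted_theta a b n i.+1 =
  a * (a * b) ^+ m * shifted_theta a b n i.
Proof.
move=> imn; rewrite /shifted_theta; case: (leqP n i) => ni.
  rewrite (leq_trans ni)// subSn// thetaS.
  have -> : (a * b) ^+ m = (a * b) ^+ (m + n - i) * (a * b) ^+ (i - n).
    by rewrite -exprD; congr (_ ^+ _); lia.
  ring.
have -> : (if (n <= i.+1)%N then theta a b (i.+1 - n) else theta b a (n - i.+1)) =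
    theta b a (n - i.+1).
  case: ifP => // h; have -> : n = i.+1 by lia.
  by rewrite subnn !theta0.
have -> : (n - i = (n - i.+1).+1)%N by lia.
rewrite thetaS; have -> : (m + n - i = m + (n - i.+1).+1)%N by lia.
rewrite exprD exprS [b * a]mulrC; ring.
Qed.

Lemma finite_product_expansion p b n :
  \prod_(0 <= j < n) (1 + b * p ^+ j) =
  \sum_(0 <= i < n.+1) qbin p n i * (b ^+ (n - i) * p ^+ 'C(n - i, 2)).
Proof.
elim: n b => [|n IH] b.
  by rewrite big_geq// big_nat1 qbin0 subnn bin0n !expr0 !mulr1.
rewrite big_nat_recl// expr0 mulr1.
under eq_bigr => j _ do rewrite exprS mulrA.
rewrite IH sum_qbinS mulr_sumr; apply: eq_big_nat => i /andP[_ iN].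
rewrite subSS subSn// bin2S !exprD exprS exprMn; ring.
Qed.

Lemma finite_triple_product_expansion a b m n :
  (\prod_(0 <= j < m) (1 + a * (a * b) ^+ j)) *
  (\prod_(0 <= j < n) (1 + b * (a * b) ^+ j)) =
  \sum_(0 <= i < (m + n).+1) qbin (a * b) (m + n) i * shifted_theta a b n i.
Proof.
elim: m => [|m IH].
  rewrite big_geq// mul1r add0n finite_product_expansion.
  apply: eq_big_nat => i /andP[_ iN]; congr (_ * _).
  have -> : shifted_theta a b n i = theta b a (n - i).
    rewrite /shifted_theta; case: ifP => // h; have -> : n = i by lia.
    by rewrite subnn !theta0.
  by rewrite thetaE [b * a]mulrC.
rewrite big_nat_recr//= mulrAC IH addSn sum_qbinS mulr_suml.
apply: eq_big_nat => i /andP[_ iN].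
rewrite shifted_thetaS//; ring.
Qed.

Definition poch p n := \prod_(0 <= j < n) (1 - p * p ^+ j).

Lemma qbin_poch p N k : (k <= N)%N ->
  qbin p N k * (poch p k * poch p (N - k)) = poch p N.
Proof.
elim: N k => [|N IH] [|k] // kN.
- by rewrite /poch subnn qbin0 !big_geq// !mul1r.
- by rewrite subn0 qbin0 /poch [X in _ * (X * _)]big_geq// !mul1r.
rewrite subSS qbinS; have pS n : poch p n.+1 = poch p n * (1 - p ^+ n.+1).
  by rewrite /poch big_nat_recr//= exprS.
have := IH k kN; rewrite !pS => IH1.
move: kN; rewrite ltnS leq_eqVlt => /orP[/eqP kN|kN].
  have p0 : poch p 0 = 1 by rewrite /poch big_geq.
  by rewrite kN qbin_small// subnn qbinn p0; ring.
have := IH k.+1 kN; rewrite pS => IH2.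
have -> : (qbin p N k.+1 + p ^+ (N - k) * qbin p N k) *
   (poch p k * (1 - p ^+ k.+1) * poch p (N - k)) =
   qbin p N k.+1 * (poch p k * (1 - p ^+ k.+1) * poch p (N - k)) +
   p ^+ (N - k) * (1 - p ^+ k.+1) * (qbin p N k * (poch p k * poch p (N - k))).
  by ring.
rewrite IH1.
have Nk : (N - k = (N - k.+1).+1)%N by lia.
have -> : qbin p N k.+1 * (poch p k * (1 - p ^+ k.+1) * poch p (N - k)) =
   (1 - p ^+ (N - k)) * (qbin p N k.+1 * (poch p k * (1 - p ^+ k.+1) * poch p (N - k.+1))).
  by rewrite {1}Nk pS -Nk; ring.
rewrite IH2.
have -> : p ^+ N.+1 = p ^+ (N - k) * p ^+ k.+1 by rewrite -exprD; congr (_ ^+ _); lia.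
ring.
Qed.

Lemma theta_bound a b (r : R) k : `|a| <= 1 -> `|a * b| = r%:C -> 0 <= r < 1 ->
  `|theta a b k| <= (r ^+ k.-1)%:C.
Proof.
move=> a1 pr /andP[r0 r1]; rewrite thetaE normrM !normrX pr rmorphXn.
rewrite -[leRHS]mul1r; apply: ler_pM; rewrite ?exprn_ge0 ?exprn_ile1// ?ler0c//.
have r1' : r%:C <= 1 :> R[i] by rewrite lecR ltW.
apply: ler_wiXn2l; rewrite ?ler0c//.
by case: k => // k; rewrite bin2S /=; case: k => // k; rewrite bin2S; lia.
Qed.

Section Convergence.
Variables a b : R[i].
Let p : R[i] := a * b.
Hypothesis p1 : `|p| < 1.

Lemma poch_tends : tends \oo (poch p) (qp p p).
Proof. exact: qpP. Qed.

Lemma poch_neq0 n : poch p n != 0.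
Proof.
have [r /andP[r0 r1] pr] := norm_lt1 p1.
rewrite /poch; elim: n => [|n IH]; first by rewrite big_geq// oner_neq0.
rewrite big_nat_recr//= mulf_neq0//.
by case: (qp_factorV_bound n r1 r1 pr pr).
Qed.

Lemma qbin_sym N k : (k <= N)%N -> qbin p N (N - k) = qbin p N k.
Proof.
move=> kN.
have nz : poch p k * poch p (N - k) != 0 by rewrite mulf_neq0// poch_neq0.
apply: (mulIf nz); rewrite qbin_poch// [poch p k * _]mulrC.
by have := @qbin_poch p N (N - k) (leq_subr _ _); rewrite subKn.
Qed.

Lemma qbin_bound : exists B : R, forall N k, `|qbin p N k| <= B%:C.
Proof.
have [r /andP[r0 r1] pr] := norm_lt1 p1.
have [||B B0 hB] := @prod_bound R (fun j => (1 - r)^-1 * r ^+ j).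
- by apply: geometric_cvg; rewrite r0.
- by move=> j; rewrite mulr_ge0 ?invr_ge0 ?subr_ge0 ?exprn_ge0// ltW.
have Vb n : `|(poch p n)^-1| <= B%:C.
  rewrite /poch -prodfV; apply: hB => j.
  by case: (qp_factorV_bound j r1 r1 pr pr).
have pb n : `|poch p n| <= B%:C.
  apply: hB => j; apply: le_trans (qp_factor_bound j (_ : _ <= r%:C) (_ : _ <= r%:C)) _;
    rewrite ?pr// lecR.
  apply: ler_wpM2r; first exact: exprn_ge0.
  apply: le_trans (ltW r1) _.
  by rewrite -[leLHS]invr1 lef_pV2 ?posrE ?subr_gt0//; lra.
exists (B * (B * B)) => N k; have [kN|Nk] := leqP k N; last first.
  by rewrite qbin_small// normr0 ler0c; have := ltW B0; nra.
have nz : poch p k * poch p (N - k) != 0 by rewrite mulf_neq0// poch_neq0.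
have -> : qbin p N k = poch p N * ((poch p k)^-1 * (poch p (N - k))^-1).
  by apply: (mulIf nz); rewrite qbin_poch// -invfM -mulrA mulVf// mulr1.
rewrite !normrM !rmorphM; apply: ler_pM => //.
exact: ler_pM.
Qed.

Lemma central_qbin_tends k :
  tends \oo (fun n => qbin p (n + n) (n + k)) (qp p p)^-1.
Proof.
have h0 : qp p p != 0 by exact: qp_neq0.
have h1 : tends \oo (poch p \o (fun n => (n + n)%N)) (qp p p).
  by apply: (tends_comp (k := 0) _ poch_tends) => n; lia.
have h2 : tends \oo (poch p \o addn^~ k) (qp p p).
  by apply: (tends_comp (k := 0) _ poch_tends) => n; lia.
have h3 : tends \oo (poch p \o subn^~ k) (qp p p).
  by apply: (tends_comp (k := k) _ poch_tends) => n; lia.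
have -> : (qp p p)^-1 = qp p p * ((qp p p)^-1 * (qp p p)^-1).
  by rewrite mulrA divff// mul1r.
apply: tends_near (tendsM h1 (tendsM (tendsV h0 h2) (tendsV h0 h3))).
exists k => // n /= kn.
have nz : poch p (n + k) * poch p (n - k) != 0 by rewrite mulf_neq0// poch_neq0.
apply: (mulIf nz).
have -> : (n - k = (n + n) - (n + k))%N by lia.
rewrite qbin_poch; last lia.
have -> : (n + n - (n + k) = n - k)%N by lia.
by rewrite -invfM -mulrA mulVf// mulr1.
Qed.

Definition bitheta k := if k == 0%N then 1 else theta a b k + theta b a k.

Lemma finite_triple_product n :
  (\prod_(0 <= j < n) (1 + a * p ^+ j)) * (\prod_(0 <= j < n) (1 + b * p ^+ j)) =
  \sum_(0 <= k < n.+1) qbin p (n + n) (n + k) * bitheta k.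
Proof.
rewrite finite_triple_product_expansion -/p (@big_cat_nat _ _ _ n)//=; last lia.
have -> : \sum_(n <= i < (n + n).+1) qbin p (n + n) i * shifted_theta a b n i =
   \sum_(0 <= k < n.+1) qbin p (n + n) (n + k) * theta a b k.
  rewrite -{1}[n]add0n big_addn subSn ?leq_addl// addnK.
  apply: eq_bigr => k _; rewrite /shifted_theta leq_addl addnK.
  by rewrite [in RHS]addnC.
have -> : \sum_(0 <= i < n) qbin p (n + n) i * shifted_theta a b n i =
   \sum_(0 <= k < n) qbin p (n + n) (n + k.+1) * theta b a k.+1.
  rewrite big_nat_rev /= add0n; apply: eq_big_nat => k /andP[_ kn].
  rewrite -qbin_sym; last lia.
  rewrite /shifted_theta ifN; last lia.
  by congr (qbin _ _ _ * theta _ _ _); lia.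
rewrite [RHS]big_nat_recl//= [X in _ + X]big_nat_recl//= theta0 !mulr1 addrCA.
congr (_ + _); rewrite -big_split /=; apply: eq_bigr => k _.
by rewrite -mulrDr addrC.
Qed.

End Convergence.

Theorem jacobi_triple_product a b : `|a| <= 1 -> `|b| <= 1 -> `|a * b| < 1 ->
  sums (bitheta a b) (qp (- a) (a * b) * qp (- b) (a * b) * qp (a * b) (a * b)).
Proof.
move=> a1 b1 p1; have p0 : qp (a * b) (a * b) != 0 by exact: qp_neq0.
have [B hB] := qbin_bound p1.
have B0 : 0 <= B by rewrite -ler0c; exact: le_trans (hB 0 0).
have [r r01 pr] := norm_lt1 p1; have [r0 r1] := andP r01.
have [||k||S hS1 hS2] := @tannery R nat \oo _
   (fun n k => qbin (a * b) (n + n) (n + k) * bitheta a b k)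
   (fun n => \sum_(0 <= k < n.+1) qbin (a * b) (n + n) (n + k) * bitheta a b k)
   (fun k => (B * 2) * r ^+ k.-1) (fun k => (qp (a * b) (a * b))^-1 * bitheta a b k).
- have /cvg_ex[l hl] := @geometric_cvg R r (B * 2) r01.
  apply/cvg_ex; exists (l + B * 2).
  rewrite -(cvg_shiftS (series _)) /=.
  apply: (cvg_trans _ (cvgD hl (cvg_cst (B * 2)))); apply: near_eq_cvg; apply: nearW => n.
  by rewrite /series /= big_nat_recl//= expr0 mulr1 addrC.
- apply: nearW => n k; rewrite -mulrA normrM rmorphM; apply: ler_pM => //.
  have h := theta_bound k a1 pr r01.
  have h' : `|theta b a k| <= (r ^+ k.-1)%:C by apply: theta_bound => //; rewrite mulrC.
  rewrite mulr_natl mulr2n rmorphD /bitheta; case: eqP => [->|_]; last first.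
    by apply: le_trans (ler_normD _ _) (lerD _ _).
  by rewrite expr0 normr1 lerDl ler01.
- by apply: tendsM; [exact: central_qbin_tends|exact: tends_cst].
- apply: nearW => n; apply: (tends_near _ (tends_cst _)).
  exists n.+1 => // N /= nN; rewrite /series /= [RHS](@big_cat_nat _ _ _ n.+1)//=.
  rewrite [X in _ + X]big_nat_cond [X in _ + X]big1 ?addr0// => k /andP[/andP[nk _] _].
  by rewrite qbin_small ?mul0r//; lia.
have Sv : S = qp (- a) (a * b) * qp (- b) (a * b).
  apply: tends_unique hS2 _.
  apply: tends_ext (tendsM (qpP (- a) p1) (qpP (- b) p1)) => n.
  rewrite -finite_triple_product//; congr (_ * _); apply: eq_bigr => j _;
  by rewrite mulNr opprK.
rewrite -Sv; apply: tends_ext (tendsM hS1 (tends_cst (qp (a * b) (a * b)))) => n.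
by rewrite /series /= mulr_suml; apply: eq_bigr => k _; rewrite mulrAC mulVf// mul1r.
Qed.

Lemma bin2_triple k : 'C(3 * k, 2) = (9 * 'C(k, 2) + 3 * k)%N.
Proof.
elim: k => [|k IH]; first by rewrite muln0 bin0n.
have -> : (3 * k.+1 = (3 * k).+3)%N by lia.
by rewrite !bin2S IH; lia.
Qed.

Lemma theta_exprn x i j k :
  theta (x ^+ i) (x ^+ j) k = x ^+ (i * 'C(k.+1, 2) + j * 'C(k, 2)).
Proof. by rewrite /theta -!exprM -exprD. Qed.

Lemma square_theta_dissection x n :
  \sum_(0 <= k < (3 * n).+2) bitheta x x k =
  \sum_(0 <= k < n.+1) bitheta (x ^+ 9) (x ^+ 9) k +
  2 * x * \sum_(0 <= k < n.+1) bitheta (x ^+ 15) (x ^+ 3) k.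
Proof.
have xx k : theta x x k = x ^+ ('C(k.+1, 2) + 'C(k, 2)).
  by rewrite /theta exprD.
elim: n => [|n IH].
  by rewrite muln0 !big_nat_recr//= !big_geq// /bitheta /= /theta !binn; ring.
have -> : ((3 * n.+1).+2 = (3 * n).+2.+3)%N by lia.
rewrite (@big_nat_recr _ _ _ (3 * n).+4)//= (@big_nat_recr _ _ _ (3 * n).+3)//=.
rewrite (@big_nat_recr _ _ _ (3 * n).+2)//= IH.
rewrite [in RHS](@big_nat_recr _ _ _ n.+1)//= [in RHS](@big_nat_recr _ _ _ n.+1)//=.
have h0 : theta x x (3 * n).+3 = theta (x ^+ 9) (x ^+ 9) n.+1.
  rewrite xx theta_exprn; congr (_ ^+ _).
  by rewrite !bin2S bin2_triple; lia.
have h1 : theta x x (3 * n).+4 = x * theta (x ^+ 15) (x ^+ 3) n.+1.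
  rewrite xx theta_exprn -exprS; congr (_ ^+ _).
  by rewrite !bin2S bin2_triple; lia.
have h2 : theta x x (3 * n).+2 = x * theta (x ^+ 3) (x ^+ 15) n.+1.
  rewrite xx theta_exprn -exprS; congr (_ ^+ _).
  by rewrite !bin2S bin2_triple; lia.
rewrite /bitheta /= h0 h1 h2; ring.
Qed.

Lemma triangular_theta_dissection x n :
  \sum_(0 <= k < (3 * n).+2) bitheta x 1 k =
  2 * \sum_(0 <= k < n.+1) bitheta (x ^+ 6) (x ^+ 3) k +
  x * \sum_(0 <= k < n.+1) bitheta (x ^+ 9) 1 k.
Proof.
have x1 i k : theta (x ^+ i) 1 k = x ^+ (i * 'C(k.+1, 2)).
  by rewrite /theta expr1n mulr1 exprM.
have x2 i k : theta 1 (x ^+ i) k = x ^+ (i * 'C(k, 2)).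
  by rewrite /theta expr1n mul1r exprM.
elim: n => [|n IH].
  by rewrite muln0 !big_nat_recr//= !big_geq// /bitheta /= /theta !binn bin_small//; ring.
have -> : ((3 * n.+1).+2 = (3 * n).+2.+3)%N by lia.
rewrite (@big_nat_recr _ _ _ (3 * n).+4)//= (@big_nat_recr _ _ _ (3 * n).+3)//=.
rewrite (@big_nat_recr _ _ _ (3 * n).+2)//= IH.
rewrite [in RHS](@big_nat_recr _ _ _ n.+1)//= [in RHS](@big_nat_recr _ _ _ n.+1)//=.
have h0 : theta x 1 (3 * n).+3 = theta (x ^+ 6) (x ^+ 3) n.+1.
  rewrite -{1}[x]expr1 x1 theta_exprn; congr (_ ^+ _).
  by rewrite !bin2S bin2_triple; lia.
have h1 : theta 1 x (3 * n).+3 = theta (x ^+ 3) (x ^+ 6) n.+1.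
  rewrite -{1}[x]expr1 x2 theta_exprn; congr (_ ^+ _).
  by rewrite !bin2S bin2_triple; lia.
have h2 : theta x 1 (3 * n).+4 = x * theta (x ^+ 9) 1 n.+1.
  rewrite -{1}[x]expr1 !x1 -exprS; congr (_ ^+ _).
  by rewrite !bin2S bin2_triple; lia.
have h3 : theta 1 x (3 * n).+4 = theta (x ^+ 6) (x ^+ 3) n.+1.
  rewrite -{1}[x]expr1 x2 theta_exprn; congr (_ ^+ _).
  by rewrite !bin2S bin2_triple; lia.
have h4 : theta x 1 (3 * n).+2 = theta (x ^+ 3) (x ^+ 6) n.+1.
  rewrite -{1}[x]expr1 x1 theta_exprn; congr (_ ^+ _).
  by rewrite !bin2S bin2_triple; lia.
have h5 : theta 1 x (3 * n).+2 = x * theta 1 (x ^+ 9) n.+1.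
  rewrite -{1}[x]expr1 !x2 -exprS; congr (_ ^+ _).
  by rewrite !bin2S bin2_triple; lia.
rewrite /bitheta /= h0 h1 h2 h3 h4 h5; ring.
Qed.

End JacobiTripleProduct.

Section ThetaDissections.
Variable R : realType.
Implicit Types (a p q w x y z : R[i]).

Lemma qp_shift a p : `|p| < 1 -> qp a p = (1 - a) * qp (a * p) p.
Proof.
move=> p1; have h := tends_comp (h := succn) (k := 0) _ (qpP a p1).
apply: tends_unique (h _) _ => [n|]; first lia.
apply: tends_ext (tendsM (tends_cst (1 - a)) (qpP (a * p) p1)) => n /=.
rewrite big_nat_recl// expr0 mulr1; congr (_ * _).
by apply: eq_bigr => j _; rewrite exprS mulrA.
Qed.

Lemma qp_odd q : `|q| < 1 -> qp q (q ^+ 2) = f_ 1 q / f_ 2 q.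
Proof.
move=> q1; have h := f_neq0 (isT : 0 < 2)%N q1.
by apply: (mulIf h); rewrite divfK// !f_qp expr1 [in RHS]qp_split2// expr2.
Qed.

Lemma qpN q : `|q| < 1 -> qp (- q) q = f_ 2 q / f_ 1 q.
Proof.
move=> q1; have h := f_neq0 (isT : 0 < 1)%N q1.
by apply: (mulfI h); rewrite mulrCA divff// mulr1 !f_qp expr1 qpM.
Qed.

Lemma qpN_odd q : `|q| < 1 -> qp (- q) (q ^+ 2) = f_ 2 q ^+ 2 / (f_ 1 q * f_ 4 q).
Proof.
move=> q1; have q21 := norm_expr_lt1 (isT : 0 < 2)%N q1.
have h1 := f_neq0 (isT : 0 < 1)%N q1; have h2 := f_neq0 (isT : 0 < 2)%N q1.
have h4 := f_neq0 (isT : 0 < 4)%N q1.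
have := qpM q q21; rewrite qp_odd// (qp_odd q21) !f_exprM => h.
have h' : f_ 1 q / f_ 2 q != 0 by rewrite mulf_neq0// invr_eq0.
by apply: (mulfI h'); rewrite h; field; rewrite h1 h2 h4.
Qed.

Lemma f1N q : `|q| < 1 -> f_ 1 (- q) = f_ 2 q ^+ 3 / (f_ 1 q * f_ 4 q).
Proof.
move=> q1; have h1 := f_neq0 (isT : 0 < 1)%N q1.
have h4 := f_neq0 (isT : 0 < 4)%N q1.
rewrite f_qp expr1 qp_split2 ?normrN// sqrrN mulrNN -expr2 qpN_odd// -f_qp.
by field; rewrite h1 h4.
Qed.

Lemma f_oddN k q : (0 < k)%N -> odd k -> `|q| < 1 ->
  f_ k (- q) = f_ (k * 2) q ^+ 3 / (f_ k q * f_ (k * 4) q).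
Proof.
move=> k0 ko q1.
have -> : f_ k (- q) = f_ 1 (- q ^+ k).
  by rewrite !f_qp expr1 exprNn -signr_odd ko expr1 mulN1r.
by rewrite f1N ?norm_expr_lt1// !f_exprM muln1.
Qed.

Lemma f_evenN k q : ~~ odd k -> f_ k (- q) = f_ k q.
Proof. by move=> ke; rewrite !f_qp exprNn -signr_odd (negbTE ke) mul1r. Qed.

Lemma theta_subseq (t : nat -> R[i]) s (h : nat -> nat) k :
  (forall n, (n <= h n + k)%N) -> sums t s ->
  tends \oo (fun n => \sum_(0 <= i < h n) t i) s.
Proof. by move=> hk; exact: tends_comp. Qed.

(* [f_ 1 q ^+ 2 / f_ 2 q] is phi(-q) in Ramanujan's notation. *)
Lemma phi_dissection q : `|q| < 1 ->
  f_ 1 q ^+ 2 / f_ 2 q =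
  f_ 9 q ^+ 2 / f_ 18 q - 2 * q * (f_ 3 q * f_ 18 q ^+ 2 / (f_ 6 q * f_ 9 q)).
Proof.
move=> q1; have nz k (k0 : (0 < k)%N) := f_neq0 k0 q1.
have qk k (k0 : (0 < k)%N) := norm_expr_lt1 k0 q1.
have phi x : `|x| < 1 -> sums (bitheta (- x) (- x)) (f_ 1 x ^+ 2 / f_ 2 x).
  move=> x1; have xx : - x * - x = x ^+ 2 by rewrite mulrNN expr2.
  have x21 := norm_expr_lt1 (isT : 0 < 2)%N x1.
  have := @jacobi_triple_product R (- x) (- x).
  rewrite !opprK xx normrN qp_odd// -f_qp => /(_ (ltW x1) (ltW x1) x21).
  by congr sums; field; rewrite f_neq0.
have h1 := phi q q1; have h2 := phi _ (qk 9%N isT).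
have q3 := qk 3%N isT; have q15 := qk 15%N isT; have q18 := qk 18%N isT.
have := @jacobi_triple_product R (- q ^+ 15) (- q ^+ 3).
rewrite !opprK !normrN mulrNN -exprD => /(_ (ltW q15) (ltW q3) q18) h3.
move: h3; set V := qp _ _ * qp _ _ * qp _ _ => h3.
have VE : V = f_ 3 q * f_ 18 q ^+ 2 / (f_ 6 q * f_ 9 q).
  have := qp_odd q3; rewrite qp_split3; last by rewrite norm_expr_lt1.
  rewrite -!exprM -!exprD.
  have := qp_odd (qk 9%N isT); rewrite -exprM => ->; rewrite !f_exprM => h.
  rewrite /V -f_qp.
  have h0 : f_ 9 q / f_ 18 q != 0 by rewrite mulf_neq0 ?invr_eq0 ?nz.
  apply: (mulfI h0); move: h; rewrite mulrAC => h.
  rewrite [qp (q ^+ 15) _ * _]mulrC mulrA [_ / _ * _]mulrC h.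
  by field; rewrite !nz.
have k1 := theta_subseq (h := fun n => (3 * n).+2) (k := 0) _ h1.
have k2 := theta_subseq (h := succn) (k := 0) _ h2.
have k3 := theta_subseq (h := succn) (k := 0) _ h3.
apply: tends_unique (k1 _) _ => [n|]; first lia.
rewrite -VE.
have odd_expr n : odd n -> (- q) ^+ n = - q ^+ n.
  by move=> no; rewrite exprNn -signr_odd no expr1 mulN1r.
move: k2; rewrite !f_exprM => k2.
have k3' : tends \oo (fun n => 2 * q *
    \sum_(0 <= i < n.+1) bitheta (- q ^+ 15) (- q ^+ 3) i) (2 * q * V).
  by apply: tendsM; [exact: tends_cst|apply: k3 => n; lia].
apply: tends_ext (tendsB (k2 _) k3') => n; last lia.
rewrite square_theta_dissection !odd_expr//; ring.
Qed.

(* [f_ 2 q ^+ 2 / f_ 1 q] is psi(q) in Ramanujan's notation. *)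
Lemma psi_dissection q : `|q| < 1 ->
  f_ 2 q ^+ 2 / f_ 1 q =
  f_ 6 q * f_ 9 q ^+ 2 / (f_ 3 q * f_ 18 q) + q * (f_ 18 q ^+ 2 / f_ 9 q).
Proof.
move=> q1; have nz k (k0 : (0 < k)%N) := f_neq0 k0 q1.
have qk k (k0 : (0 < k)%N) := norm_expr_lt1 k0 q1.
have psi x : `|x| < 1 -> sums (bitheta x 1) (2 * (f_ 2 x ^+ 2 / f_ 1 x)).
  move=> x1; have := @jacobi_triple_product R x 1.
  rewrite mulr1 normr1 => /(_ (ltW x1) (lexx _) x1).
  rewrite (qp_shift (-1))// mulN1r opprK qpN//.
  have -> : qp x x = f_ 1 x by rewrite f_qp expr1.
  by congr sums; field; rewrite f_neq0.
have h1 := psi q q1; have h2 := psi _ (qk 9%N isT).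
have q3 := qk 3%N isT; have q6 := qk 6%N isT; have q9 := qk 9%N isT.
have := @jacobi_triple_product R (q ^+ 6) (q ^+ 3).
rewrite -exprD => /(_ (ltW q6) (ltW q3) q9) h3.
move: h3; set V := qp _ _ * qp _ _ * qp _ _ => h3.
have VE : V = f_ 6 q * f_ 9 q ^+ 2 / (f_ 3 q * f_ 18 q).
  have := qpN q3; rewrite qp_split3//.
  rewrite -!exprM !mulNr -!exprD.
  have := qpN (qk 9%N isT) => ->; rewrite !f_exprM => h.
  rewrite /V -f_qp.
  have h0 : f_ 18 q / f_ 9 q != 0 by rewrite mulf_neq0 ?invr_eq0 ?nz.
  apply: (mulfI h0).
  rewrite [qp (- q ^+ 6) _ * _]mulrC mulrA [_ / _ * _]mulrC h.
  by field; rewrite !nz.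
have k1 := theta_subseq (h := fun n => (3 * n).+2) (k := 0) _ h1.
have k2 := theta_subseq (h := succn) (k := 0) _ h2.
have k3 := theta_subseq (h := succn) (k := 0) _ h3.
have n2 : 2 != 0 :> R[i] by rewrite pnatr_eq0.
apply: (mulfI n2); apply: tends_unique (k1 _) _ => [n|]; first lia.
rewrite -VE.
move: k2; rewrite !f_exprM => k2.
have k3' : tends \oo (fun n => 2 * \sum_(0 <= i < n.+1) bitheta (q ^+ 6) (q ^+ 3) i) (2 * V).
  by apply: tendsM; [exact: tends_cst|apply: k3 => n; lia].
have k2' : tends \oo (fun n => q * \sum_(0 <= i < n.+1) bitheta (q ^+ 9) 1 i)
    (2 * (q * (f_ 18 q ^+ 2 / f_ 9 q))).
  by rewrite mulrCA; apply: tendsM; [exact: tends_cst|apply: k2 => n; lia].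
rewrite mulrDr; apply: tends_ext (tendsD k3' k2') => n.
exact/esym/triangular_theta_dissection.
Qed.

End ThetaDissections.

Section CubeRootIdentities.
Variable F : fieldType.
Implicit Types (a b c d e g m n w x y z : F).

Lemma cube_root1_expr w : w ^+ 2 + w + 1 = 0 -> w ^+ 3 = 1.
Proof.
move=> w0; apply/eqP; rewrite -subr_eq0.
have -> : w ^+ 3 - 1 = (w - 1) * (w ^+ 2 + w + 1) by ring.
by rewrite w0 mulr0.
Qed.

Lemma mul3_ratio_sqr a b c d e g :
  (a * b * c) ^+ 2 / (d * e * g) = a ^+ 2 / d * (b ^+ 2 / e) * (c ^+ 2 / g).
Proof. by rewrite !invfM; ring. Qed.

Lemma cube_rootsD w x y : w ^+ 2 + w + 1 = 0 ->
  (x + y) * (x + w * y) * (x + w ^+ 2 * y) = x ^+ 3 + y ^+ 3.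
Proof.
move=> w0; apply/eqP; rewrite -subr_eq0.
have -> : (x + y) * (x + w * y) * (x + w ^+ 2 * y) - (x ^+ 3 + y ^+ 3) =
  (w ^+ 2 + w + 1) * (x ^+ 2 * y + w * x * y ^+ 2 + (w - 1) * y ^+ 3) by ring.
by rewrite w0 mul0r.
Qed.

Lemma phi_cube_roots w a b c d e g x y z m n : w ^+ 2 + w + 1 = 0 ->
  a * b * c = m -> d * e * g = n ->
  a ^+ 2 / d = x - 2 * z * y -> b ^+ 2 / e = x - 2 * (w * z) * y ->
  c ^+ 2 / g = x - 2 * (w ^+ 2 * z) * y ->
  m ^+ 2 / n = x ^+ 3 - 8 * z ^+ 3 * y ^+ 3.
Proof.
move=> w0 <- <- ha hb hc; rewrite mul3_ratio_sqr ha hb hc.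
transitivity (x ^+ 3 + (- 2 * z * y) ^+ 3); last by ring.
by rewrite -(cube_rootsD _ _ w0); ring.
Qed.

Lemma psi_cube_roots w a b c d e g x y z m n : w ^+ 2 + w + 1 = 0 ->
  a * b * c = m -> d * e * g = n ->
  a ^+ 2 / d = x + z * y -> b ^+ 2 / e = x + w * z * y ->
  c ^+ 2 / g = x + w ^+ 2 * z * y ->
  m ^+ 2 / n = x ^+ 3 + z ^+ 3 * y ^+ 3.
Proof.
move=> w0 <- <- ha hb hc; rewrite mul3_ratio_sqr ha hb hc.
by rewrite -exprMn -(cube_rootsD _ _ w0) !mulrA.
Qed.

End CubeRootIdentities.

Section CubicModulus.
Variable R : realType.
Implicit Types (q w x y z : R[i]).

Lemma cube_root1 w : w ^+ 2 + w + 1 = 0 -> w ^+ 3 = 1 /\ `|w| = 1.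
Proof.
move=> w0; have w3 := cube_root1_expr w0.
by split=> //; apply/eqP; rewrite -(@pexpr_eq1 _ _ 3)// -normrX w3 normr1.
Qed.

Lemma f_mul3 w k q : (3 %| k)%N -> w ^+ 3 = 1 -> f_ k (w * q) = f_ k q.
Proof.
by move=> /dvdnP[m ->] w3; rewrite !f_qp exprMn mulnC exprM w3 expr1n mul1r.
Qed.

Lemma f_cube_roots w q : w ^+ 2 + w + 1 = 0 -> `|q| < 1 ->
  f_ 1 q * f_ 1 (w * q) * f_ 1 (w ^+ 2 * q) = f_ 3 q ^+ 4 / f_ 9 q.
Proof.
move=> w0 q1.
have [w3 w1] := cube_root1 w0.
have nz k (k0 : (0 < k)%N) := f_neq0 k0 q1.
have qk k (k0 : (0 < k)%N) := norm_expr_lt1 k0 q1.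
have w0' : (w ^+ 2) ^+ 2 + w ^+ 2 + 1 = 0.
  have -> : (w ^+ 2) ^+ 2 = w ^+ 3 * w by ring.
  by rewrite w3 mul1r -w0; ring.
have fE x : `|x| < 1 -> f_ 1 x = qp x (x ^+ 3) * qp (x ^+ 2) (x ^+ 3) * f_ 3 x.
  by move=> x1; rewrite !f_qp expr1 qp_split3// -expr2 -exprS.
have e1 := qpM3 q w0 (qk 3%N isT).
have e2 := qpM3 (q ^+ 2) w0' (qk 3%N isT).
have w23 : (w ^+ 2) ^+ 3 = 1 by rewrite -exprM mulnC exprM w3 expr1n.
have wq1 : `|w * q| < 1 by rewrite normrM w1 mul1r.
have wwq1 : `|w ^+ 2 * q| < 1 by rewrite normrM normrX w1 expr1n mul1r.
rewrite (fE q)// (fE (w * q))// (fE (w ^+ 2 * q))// !f_mul3// !exprMn w3 -(expr2 (w ^+ 2)) !mul1r.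
have h : qp (q ^+ 3) (q ^+ 9) * qp (q ^+ 6) (q ^+ 9) = f_ 3 q / f_ 9 q.
  apply: (mulIf (nz 9%N isT)); rewrite divfK ?nz//.
  by have := fE _ (qk 3%N isT); rewrite !f_exprM -!exprM => <-.
move: e1 e2; rewrite -!(exprM q) => e1 e2.
transitivity ((qp q (q ^+ 3) * qp (w * q) (q ^+ 3) * qp (w ^+ 2 * q) (q ^+ 3)) *
  (qp (q ^+ 2) (q ^+ 3) * qp (w ^+ 2 * q ^+ 2) (q ^+ 3) *
   qp ((w ^+ 2) ^+ 2 * q ^+ 2) (q ^+ 3)) * f_ 3 q ^+ 3); first ring.
by rewrite e1 e2 h; field; rewrite nz.
Qed.

Lemma f2_cube_roots w q : w ^+ 2 + w + 1 = 0 -> `|q| < 1 ->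
  f_ 2 q * f_ 2 (w * q) * f_ 2 (w ^+ 2 * q) = f_ 6 q ^+ 4 / f_ 18 q.
Proof.
move=> w0 q1; have h x : f_ 2 x = f_ 1 (x ^+ 2) by rewrite f_exprM.
have w0' : (w ^+ 2) ^+ 2 + w ^+ 2 + 1 = 0.
  have -> : (w ^+ 2) ^+ 2 + w ^+ 2 + 1 = (w ^+ 2 + w + 1) * (w ^+ 2 - w + 1) by ring.
  by rewrite w0 mul0r.
have q21 := norm_expr_lt1 (isT : 0 < 2)%N q1.
have := f_cube_roots w0' q21.
rewrite (f_exprM 3) (f_exprM 9) -!exprMn -!h; exact.
Qed.

Lemma cube_root1_exists : exists w : R[i], w ^+ 2 + w + 1 = 0.
Proof.
have [w hw] := @solve_monicpoly R[i] 2 (fun=> -1) isT.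
exists w; rewrite hw !big_ord_recl big_ord0 /= expr0 expr1; ring.
Qed.

Lemma root_exists n q : (0 < n)%N -> `|q| < 1 -> exists2 z, z ^+ n = q & `|z| < 1.
Proof.
move=> n0 q1; exists (n.-root q); first exact: rootCK.
by rewrite -(@expr_lt1 _ n)// -normrX rootCK.
Qed.

(* The next two identities come from multiplying the dissections of phi and psi
   at q, w q, w^2 q, where w is a primitive cube root of unity. *)
Lemma phi_cube y : `|y| < 1 ->
  (f_ 1 y ^+ 4 / f_ 3 y) ^+ 2 / (f_ 2 y ^+ 4 / f_ 6 y) =
  (f_ 3 y ^+ 2 / f_ 6 y) ^+ 3 - 8 * y * (f_ 1 y * f_ 6 y ^+ 2 / (f_ 2 y * f_ 3 y)) ^+ 3.
Proof.
move=> y1; have [q <- q1] := root_exists (isT : 0 < 3)%N y1.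
have [w w0] := cube_root1_exists.
have [w3 w1] := cube_root1 w0.
have w23 : (w ^+ 2) ^+ 3 = 1 by rewrite -exprM mulnC exprM w3 expr1n.
have wq1 : `|w * q| < 1 by rewrite normrM w1 mul1r.
have wwq1 : `|w ^+ 2 * q| < 1 by rewrite normrM normrX w1 expr1n mul1r.
have d1 := phi_dissection q1; have d2 := phi_dissection wq1.
have d3 := phi_dissection wwq1.
have inv3 v (hv : v ^+ 3 = 1) : (f_ 3 (v * q) = f_ 3 q) * (f_ 6 (v * q) = f_ 6 q) *
   (f_ 9 (v * q) = f_ 9 q) * (f_ 18 (v * q) = f_ 18 q).
  exact: (f_mul3 q (isT : 3 %| 3)%N hv, f_mul3 q (isT : 3 %| 6)%N hv,
    f_mul3 q (isT : 3 %| 9)%N hv, f_mul3 q (isT : 3 %| 18)%N hv).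
rewrite !(inv3 w) ?(inv3 (w ^+ 2))// in d2 d3.
move: (phi_cube_roots w0 (f_cube_roots w0 q1) (f2_cube_roots w0 q1) d1 d2 d3)
  (f_exprM 1 3 q) (f_exprM 2 3 q) (f_exprM 3 3 q) (f_exprM 6 3 q).
generalize (f_ 1 (q ^+ 3)) (f_ 2 (q ^+ 3)) (f_ 3 (q ^+ 3)) (f_ 6 (q ^+ 3)).
by move=> F1 F2 F3 F6 h -> -> -> ->; exact: h.
Qed.

Lemma psi_cube y : `|y| < 1 ->
  (f_ 2 y ^+ 4 / f_ 6 y) ^+ 2 / (f_ 1 y ^+ 4 / f_ 3 y) =
  (f_ 2 y * f_ 3 y ^+ 2 / (f_ 1 y * f_ 6 y)) ^+ 3 + y * (f_ 6 y ^+ 2 / f_ 3 y) ^+ 3.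
Proof.
move=> y1; have [q <- q1] := root_exists (isT : 0 < 3)%N y1.
have [w w0] := cube_root1_exists.
have [w3 w1] := cube_root1 w0.
have w23 : (w ^+ 2) ^+ 3 = 1 by rewrite -exprM mulnC exprM w3 expr1n.
have wq1 : `|w * q| < 1 by rewrite normrM w1 mul1r.
have wwq1 : `|w ^+ 2 * q| < 1 by rewrite normrM normrX w1 expr1n mul1r.
have d1 := psi_dissection q1; have d2 := psi_dissection wq1.
have d3 := psi_dissection wwq1.
have inv3 v (hv : v ^+ 3 = 1) : (f_ 3 (v * q) = f_ 3 q) * (f_ 6 (v * q) = f_ 6 q) *
   (f_ 9 (v * q) = f_ 9 q) * (f_ 18 (v * q) = f_ 18 q).
  exact: (f_mul3 q (isT : 3 %| 3)%N hv, f_mul3 q (isT : 3 %| 6)%N hv,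
    f_mul3 q (isT : 3 %| 9)%N hv, f_mul3 q (isT : 3 %| 18)%N hv).
rewrite !(inv3 w) ?(inv3 (w ^+ 2))// in d2 d3.
move: (psi_cube_roots w0 (f2_cube_roots w0 q1) (f_cube_roots w0 q1) d1 d2 d3)
  (f_exprM 1 3 q) (f_exprM 2 3 q) (f_exprM 3 3 q) (f_exprM 6 3 q).
generalize (f_ 1 (q ^+ 3)) (f_ 2 (q ^+ 3)) (f_ 3 (q ^+ 3)) (f_ 6 (q ^+ 3)).
by move=> F1 F2 F3 F6 h -> -> -> ->; exact: h.
Qed.

End CubicModulus.

Section HalfSum.
Variable R : realType.
Implicit Types (q x y z Q : R[i]).

Definition cubic_u q : R[i] := f_ 2 q * f_ 3 q ^+ 3 / (f_ 1 q * f_ 6 q ^+ 3).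
Definition half_sum q : R[i] := f_ 2 q ^+ 3 / (f_ 1 q * f_ 3 q * f_ 6 q).

Lemma cubic_u_neq0 q : `|q| < 1 -> cubic_u q != 0.
Proof.
move=> q1; have nz k (k0 : (0 < k)%N) := f_neq0 k0 q1.
by rewrite /cubic_u mulf_neq0 ?invr_eq0 ?mulf_neq0 ?expf_neq0 ?nz.
Qed.

Lemma half_sum_neq0 q : `|q| < 1 -> half_sum q != 0.
Proof.
move=> q1; have nz k (k0 : (0 < k)%N) := f_neq0 k0 q1.
by rewrite /half_sum mulf_neq0 ?invr_eq0 ?mulf_neq0 ?expf_neq0 ?nz.
Qed.

Lemma cubic_uM q : `|q| < 1 -> cubic_u q * cubic_u (- q) = cubic_u (q ^+ 2).
Proof.
move=> q1; have nz k (k0 : (0 < k)%N) := f_neq0 k0 q1.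
rewrite /cubic_u.
have -> : f_ 1 (- q) = f_ 2 q ^+ 3 / (f_ 1 q * f_ 4 q) by exact: f_oddN.
have -> : f_ 3 (- q) = f_ 6 q ^+ 3 / (f_ 3 q * f_ 12 q) by exact: f_oddN.
have -> : f_ 2 (- q) = f_ 2 q by exact: f_evenN.
have -> : f_ 6 (- q) = f_ 6 q by exact: f_evenN.
have -> : f_ 1 (q ^+ 2) = f_ 2 q by exact: f_exprM.
have -> : f_ 2 (q ^+ 2) = f_ 4 q by exact: f_exprM.
have -> : f_ 3 (q ^+ 2) = f_ 6 q by exact: f_exprM.
have -> : f_ 6 (q ^+ 2) = f_ 12 q by exact: f_exprM.
by field; rewrite !nz.
Qed.

Lemma phi_cubic_u q : `|q| < 1 -> f_ 1 q ^+ 2 / f_ 2 q =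
  f_ 9 q ^+ 2 / f_ 18 q * (1 - 2 * q / cubic_u (q ^+ 3)).
Proof.
move=> q1; have nz k (k0 : (0 < k)%N) := f_neq0 k0 q1.
rewrite phi_dissection// /cubic_u.
have -> : f_ 1 (q ^+ 3) = f_ 3 q by exact: f_exprM.
have -> : f_ 2 (q ^+ 3) = f_ 6 q by exact: f_exprM.
have -> : f_ 3 (q ^+ 3) = f_ 9 q by exact: f_exprM.
have -> : f_ 6 (q ^+ 3) = f_ 18 q by exact: f_exprM.
by field; rewrite !nz.
Qed.

Lemma phiN_cubic_u q : `|q| < 1 -> (f_ 2 q ^+ 3 / (f_ 1 q * f_ 4 q)) ^+ 2 / f_ 2 q =
  (f_ 18 q ^+ 3 / (f_ 9 q * f_ 36 q)) ^+ 2 / f_ 18 q *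
  (1 + 2 * q / cubic_u (- q ^+ 3)).
Proof.
move=> q1.
have <- : f_ 1 (- q) = f_ 2 q ^+ 3 / (f_ 1 q * f_ 4 q) by exact: f_oddN.
have <- : f_ 9 (- q) = f_ 18 q ^+ 3 / (f_ 9 q * f_ 36 q) by exact: f_oddN.
have <- : f_ 2 (- q) = f_ 2 q by exact: f_evenN.
have <- : f_ 18 (- q) = f_ 18 q by exact: f_evenN.
have -> : - q ^+ 3 = (- q) ^+ 3 by ring.
rewrite phi_cubic_u ?normrN//; ring.
Qed.

Lemma phi_sqr_cubic_u q : `|q| < 1 -> f_ 2 q ^+ 2 / f_ 4 q =
  f_ 18 q ^+ 2 / f_ 36 q * (1 - 2 * q ^+ 2 / cubic_u (q ^+ 6)).
Proof.
move=> q1; have q21 := norm_expr_lt1 (isT : 0 < 2)%N q1.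
have <- : f_ 1 (q ^+ 2) = f_ 2 q by exact: f_exprM.
have <- : f_ 2 (q ^+ 2) = f_ 4 q by exact: f_exprM.
have <- : f_ 9 (q ^+ 2) = f_ 18 q by exact: f_exprM.
have <- : f_ 18 (q ^+ 2) = f_ 36 q by exact: f_exprM.
have -> : q ^+ 6 = (q ^+ 2) ^+ 3 by ring.
exact: phi_cubic_u.
Qed.

Lemma phi_quotients_difference (F : fieldType) (f1 f2 f4 f9 f18 f36 z u v w : F) :
  [&& f1 != 0, f2 != 0, f4 != 0, f9 != 0, f18 != 0 & f36 != 0] ->
  [&& z != 0, u != 0, v != 0, w != 0 & 2 != 0 :> F] ->
  f1 ^+ 2 / f2 = f9 ^+ 2 / f18 * (1 - 2 * z / u) ->
  (f2 ^+ 3 / (f1 * f4)) ^+ 2 / f2 =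
    (f18 ^+ 3 / (f9 * f36)) ^+ 2 / f18 * (1 + 2 * z / v) ->
  f2 ^+ 2 / f4 = f18 ^+ 2 / f36 * (1 - 2 * z ^+ 2 / w) ->
  u * v = w -> u - v = 2 * z ^+ 3 / w.
Proof.
move=> /and5P[n1 n2 n4 n9 /andP[n18 n36]] /and5P[nz nu nv nw nn] e1 e2 e3 uv.
have e : (1 - 2 * z / u) * (1 + 2 * z / v) = (1 - 2 * z ^+ 2 / w) ^+ 2.
  have nA : (f18 ^+ 2 / f36) ^+ 2 != 0.
    by rewrite expf_neq0// mulf_neq0 ?invr_eq0// expf_neq0.
  apply: (mulfI nA); rewrite -exprMn -e3.
  transitivity ((f1 ^+ 2 / f2) * ((f2 ^+ 3 / (f1 * f4)) ^+ 2 / f2)); last first.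
    by field; rewrite n1 n2 n4.
  by rewrite e1 e2; field; rewrite n9 n18 n36 nu nv.
have e' : 2 * z * (u - v) = 2 * z * (2 * z ^+ 3 / w).
  have : (1 - 2 * z / u) * (1 + 2 * z / v) * w = (1 - 2 * z ^+ 2 / w) ^+ 2 * w by rewrite e.
  have -> : (1 - 2 * z / u) * (1 + 2 * z / v) * w = w + 2 * z * (u - v) - 4 * z ^+ 2.
    by rewrite -uv; field; rewrite nu nv.
  have -> : (1 - 2 * z ^+ 2 / w) ^+ 2 * w =
      w + 2 * z * (2 * z ^+ 3 / w) - 4 * z ^+ 2 by field; rewrite nw.
  by move=> /addIr /addrI.
by apply: (mulfI _ e'); rewrite mulf_neq0.
Qed.

Lemma cubic_uB Q : `|Q| < 1 -> cubic_u Q - cubic_u (- Q) = 2 * Q / cubic_u (Q ^+ 2).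
Proof.
move=> Q1; have [->|Q0] := eqVneq Q 0; first by rewrite oppr0 subrr mulr0 mul0r.
have [z zQ z1] := root_exists (isT : 0 < 3)%N Q1.
have nz k (k0 : (0 < k)%N) := f_neq0 k0 z1.
have z0 : z != 0 by apply: contra_neq Q0 => z0; rewrite -zQ z0 expr0n.
have Q21 := norm_expr_lt1 (isT : 0 < 2)%N Q1.
have e1 := phi_cubic_u z1; have e2 := phiN_cubic_u z1; have e3 := phi_sqr_cubic_u z1.
rewrite zQ in e1 e2; have z6 : z ^+ 6 = Q ^+ 2 by rewrite -zQ; ring.
rewrite z6 in e3.
have n2 : 2 != 0 :> R[i] by rewrite pnatr_eq0.
rewrite -[in RHS]zQ [in RHS]zQ -[X in 2 * X]zQ.
apply: phi_quotients_difference e1 e2 e3 (cubic_uM Q1).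
  by apply/and5P; split; try apply/andP; rewrite ?nz.
by apply/and5P; split=> //; apply: cubic_u_neq0 => //; rewrite normrN.
Qed.

Lemma half_sum_relation (F : fieldType) (f1 f2 f3 f6 x : F) :
  [&& f1 != 0, f2 != 0, f3 != 0 & f6 != 0] ->
  (f2 ^+ 4 / f6) ^+ 2 / (f1 ^+ 4 / f3) =
    (f2 * f3 ^+ 2 / (f1 * f6)) ^+ 3 + x * (f6 ^+ 2 / f3) ^+ 3 ->
  forall u v w, w = f2 * f3 ^+ 3 / (f1 * f6 ^+ 3) -> u * v = w ->
  (u - v) ^+ 2 = 4 * x / w ^+ 2 ->
  (u + v) ^+ 2 = (2 * (f2 ^+ 3 / (f1 * f3 * f6))) ^+ 2.
Proof.
move=> /and4P[n1 n2 n3 n6] e u v w we uv uv2.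
have -> : (u + v) ^+ 2 = (u - v) ^+ 2 + 4 * (u * v) by ring.
have n : (f6 ^+ 2 / f3) ^+ 3 != 0.
  by rewrite expf_neq0// mulf_neq0 ?expf_neq0 ?invr_eq0.
have xE : x = ((f2 ^+ 4 / f6) ^+ 2 / (f1 ^+ 4 / f3) -
    (f2 * f3 ^+ 2 / (f1 * f6)) ^+ 3) / (f6 ^+ 2 / f3) ^+ 3.
  by rewrite e addrAC subrr add0r mulfK.
by rewrite uv2 uv xE we; field; rewrite n1 n2 n3 n6.
Qed.

Lemma cubic_u_sqrD Q : `|Q| < 1 ->
  (cubic_u Q + cubic_u (- Q)) ^+ 2 = (2 * half_sum (Q ^+ 2)) ^+ 2.
Proof.
move=> Q1; have Q21 := norm_expr_lt1 (isT : 0 < 2)%N Q1.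
have nz k (k0 : (0 < k)%N) := f_neq0 k0 Q21.
apply: (half_sum_relation _ (psi_cube Q21) (erefl (cubic_u (Q ^+ 2))) (cubic_uM Q1)).
  by apply/and4P; split; exact: nz.
rewrite cubic_uB//; move: (cubic_u (Q ^+ 2)) => w.
by rewrite expr_div_n exprMn -natrX.
Qed.

End HalfSum.

Section HalfSumSign.
Variable R : realType.
Implicit Types (q x y z Q : R[i]).

Lemma norm_real_complex (a : R) : `|a%:C| = `|a|%:C.
Proof. by rewrite normc_def /= expr0n addr0 sqrtr_sqr. Qed.

Lemma tends_real T (F : set_system T) {FF : Filter F} (f : T -> R) (l : R) :
  f @ F --> l -> tends F (fun t => (f t)%:C) l%:C.
Proof.
move=> /cvgrPdist_lt fl; apply/tendsP => e e0; apply: filterS (fl e e0) => t.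
by rewrite -rmorphB norm_real_complex ltcR.
Qed.

Section Continuity.
Variables (T : Type) (F : set_system T).
Context {FF : ProperFilter F}.
Variables (y : T -> R[i]) (r : R) (q : R[i]).
Hypotheses (r01 : 0 <= r < 1) (yr : forall t, `|y t| <= r%:C) (yq : tends F y q).

Lemma tends_lt1 : `|q| < 1.
Proof.
have h : `|q| <= r%:C by apply: tends_le yq _; apply: nearW.
by apply: le_lt_trans h _; rewrite ltcR; case/andP: r01.
Qed.

Let fy k (k0 : (0 < k)%N) : tends F (fun t => f_ k (y t)) (f_ k q).
Proof. exact: (f_tends k0 r01 yr yq). Qed.

Let nz k (k0 : (0 < k)%N) : f_ k q != 0.
Proof. by rewrite f_neq0// tends_lt1. Qed.

Lemma cubic_u_tends : tends F (fun t => cubic_u (y t)) (cubic_u q).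
Proof.
apply: tendsM; first by apply: tendsM; [exact: fy|apply: tendsX; exact: fy].
apply: tendsV; first by rewrite mulf_neq0 ?expf_neq0 ?nz.
by apply: tendsM; [exact: fy|apply: tendsX; exact: fy].
Qed.

Lemma half_sum_tends : tends F (fun t => half_sum (y t)) (half_sum q).
Proof.
apply: tendsM; first by apply: tendsX; exact: fy.
apply: tendsV; first by rewrite !mulf_neq0 ?nz.
by apply: tendsM; [apply: tendsM; exact: fy|exact: fy].
Qed.

End Continuity.

(* The squares agree by [cubic_u_sqrD], so the quotient of the two sides is 1 or
   -1; it is continuous along the segment [cos t * Q] joining [Q] to [0], where
   it is 1. *)
Lemma cubic_uD Q : `|Q| < 1 -> cubic_u Q + cubic_u (- Q) = 2 * half_sum (Q ^+ 2).
Proof.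
move=> Q1; have [r r01 Qr] := norm_lt1 Q1; have [r0 r1] := andP r01.
pose x (t : R) := (cos t)%:C * Q.
have xr t : `|x t| <= r%:C.
  rewrite normrM Qr norm_real_complex; apply: ler_piMl; first by rewrite ler0c.
  by rewrite lecR ler_norml cos_geN1 cos_le1.
have nxr t : `|- x t| <= r%:C by rewrite normrN.
have rC1 : r%:C <= 1 :> R[i] by rewrite lecR ltW.
have x2r t : `|x t ^+ 2| <= r%:C.
  rewrite normrX expr2; apply: le_trans (xr t); apply: ler_piMr => //.
  exact: le_trans (xr t) rC1.
have x1 t : `|x t| < 1 by apply: le_lt_trans (xr t) _; rewrite ltcR.
have n2 : 2 != 0 :> R[i] by rewrite pnatr_eq0.
have d0 t : 2 * half_sum (x t ^+ 2) != 0.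
  by rewrite mulf_neq0// half_sum_neq0// norm_expr_lt1.
pose s t := (cubic_u (x t) + cubic_u (- x t)) / (2 * half_sum (x t ^+ 2)).
have s2 t : s t = 1 \/ s t = -1.
  have : (s t) ^+ 2 = 1 by rewrite expr_div_n cubic_u_sqrD// divff// expf_neq0.
  by move/eqP; rewrite sqrf_eq1 => /orP[]/eqP ->; [left|right].
have xc t0 : tends (nbhs t0) x (x t0).
  by apply: tendsM (tends_cst _); apply: tends_real; exact: continuous_cos.
have sc t0 : tends (nbhs t0) s (s t0).
  apply: tendsM.
    apply: tendsD; first exact: (cubic_u_tends r01 xr (xc t0)).
    exact: (cubic_u_tends r01 nxr (tendsN (xc t0))).
  apply: tendsV => //; apply: tendsM; first exact: tends_cst.
  exact: (half_sum_tends r01 x2r (tendsX 2 (xc t0))).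
have hc : continuous (fun t => complex.Re (s t)) by move=> t0; exact: tends_Re (sc t0).
have xpi : x (pi / 2) = 0 by rewrite /x cos_pihalf mul0r.
have spi : s (pi / 2) = 1.
  rewrite /s xpi oppr0 expr0n /= /cubic_u /half_sum.
  rewrite (@f0 R 1)// (@f0 R 2)// (@f0 R 3)// (@f0 R 6)// !expr1n !mulr1 !divr1.
  by rewrite [2 * 1]mulr1 -mulr2n divff.
have x0 : x 0 = Q by rewrite /x cos0 mul1r.
have s0 : s 0 = 1.
  case: (s2 0) => [//|sN1].
  exfalso; have [|||t _] := @IVT R (fun t => complex.Re (s t)) 0 (pi / 2) 0.
  - by rewrite divr_ge0// pi_ge0.
  - exact: continuous_subspaceT.
  - by rewrite sN1 spi /= ge_min le_max lerN10 ler01 orbT.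
  have Re1 : complex.Re (1 : R[i]) = 1 by [].
  case: (s2 t) => st; rewrite st ?raddfN /= ?Re1 => /eqP.
    by rewrite oner_eq0.
  by rewrite oppr_eq0 oner_eq0.
have : s 0 * (2 * half_sum (x 0 ^+ 2)) = cubic_u (x 0) + cubic_u (- x 0).
  by rewrite divfK.
by rewrite s0 mul1r x0 => ->.
Qed.

End HalfSumSign.

Section CountingSequence.
Variable R : realType.
Implicit Types (p h : {poly nat}) (q x : R[i]).

Definition poly_le p h := forall k, ((p`_k)%R <= (h`_k)%R)%N.

Lemma poly_leM p1 h1 p2 h2 :
  poly_le p1 h1 -> poly_le p2 h2 -> poly_le (p1 * p2) (h1 * h2).
Proof.
move=> le1 le2 k; rewrite !coefM.
apply: (big_ind2 (fun m n : nat => (m <= n)%N)) => // [m1 n1 m2 n2 hm hn|i _].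
  exact: leq_add.
exact: leq_mul.
Qed.

Lemma poly_le_prod (u v : nat -> {poly nat}) n : (forall j, poly_le (u j) (v j)) ->
  poly_le (\prod_(0 <= j < n) u j) (\prod_(0 <= j < n) v j).
Proof.
move=> uv; elim: n => [|n IH]; first by rewrite !big_geq.
by rewrite !big_nat_recr//=; exact: poly_leM.
Qed.

Lemma poly_le_prod_widen (u : nat -> {poly nat}) m n : (m <= n)%N ->
  (forall j, poly_le 1 (u j)) ->
  poly_le (\prod_(0 <= j < m) u j) (\prod_(0 <= j < n) u j).
Proof.
move=> /subnKC <- u1; elim: (n - m)%N => [|d IH]; first by rewrite addn0.
rewrite addnS big_nat_recr//= => k; apply: leq_trans (IH k) _.
by rewrite -{1}[\prod_(0 <= j < m + d) u j]mulr1; apply: poly_leM.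
Qed.

Definition nat_eval q h : R[i] := (map_poly (GRing.natmul 1) h).[q].

Lemma sums_nat_eval q h : sums (fun k => (h`_k)%R%:R * q ^+ k) (nat_eval q h).
Proof.
apply: (tends_near _ (tends_cst _)); exists (size h) => // n /= hn.
rewrite /nat_eval (@horner_coef_wide _ n); last first.
  exact: leq_trans (size_poly _ _) hn.
rewrite /series /= big_mkord; apply: eq_bigr => i _.
by rewrite coef_map.
Qed.

Lemma nat_eval_ge (r : R) h K : 0 <= r ->
  (\sum_(0 <= k < K) (h`_k)%R%:R * r ^+ k)%:C <= nat_eval r%:C h.
Proof.
move=> r0; rewrite /nat_eval (@horner_coef_wide _ (maxn (size h) K)); last first.
  by apply: leq_trans (size_poly _ _) _; exact: leq_maxl.
rewrite -(big_mkord predT (fun i => (map_poly (GRing.natmul 1) h)`_i * r%:C ^+ i)).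
rewrite [leRHS](@big_cat_nat _ _ _ K)//=; last exact: leq_maxr.
have e k : (map_poly (GRing.natmul (1 : R[i])) h)`_k * r%:C ^+ k =
    ((h`_k)%R%:R * r ^+ k)%:C.
  by rewrite coef_map rmorphM rmorph_nat rmorphXn.
have eS m n : \sum_(m <= k < n) (map_poly (GRing.natmul (1 : R[i])) h)`_k * r%:C ^+ k =
    (\sum_(m <= k < n) (h`_k)%R%:R * r ^+ k)%:C.
  by rewrite rmorph_sum; apply: eq_bigr => k _; exact: e.
rewrite !eS -rmorphD lecR lerDl; apply: sumr_ge0 => k _.
by rewrite mulr_ge0// exprn_ge0.
Qed.

Lemma bounded_nat_stationary (u : nat -> nat) M :
  {homo u : m n / (m <= n)%N} -> (forall n, u n <= M)%N ->
  exists s, (forall n, u n <= s)%N /\ exists N, forall n, (N <= n)%N -> u n = s.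
Proof.
move=> um uM.
have ex : exists m, `[< exists n, u n = m >] by exists (u 0); apply/asboolP; exists 0.
have ub m : `[< exists n, u n = m >] -> (m <= M)%N by move=> /asboolP[n <-].
case: (ex_maxnP ex ub) => s /asboolP[N uN] smax; exists s; split=> [n|].
  by apply: smax; apply/asboolP; exists n.
exists N => n Nn; apply/eqP; rewrite eqn_leq -{2}uN um// andbT.
by apply: smax; apply/asboolP; exists n.
Qed.

Lemma counting_sequence_exists (h : nat -> {poly nat}) (G : R[i] -> R[i]) :
  (forall m n, (m <= n)%N -> poly_le (h m) (h n)) ->
  (forall q, `|q| < 1 -> tends \oo (fun N => nat_eval q (h N)) (G q)) ->
  exists S : nat -> nat, forall q, `|q| < 1 ->
    sums (fun n => (S n)%:R * q ^+ n) (G q).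
Proof.
move=> hm hG.
have bnd (r : R) : 0 <= r < 1 ->
    exists B : R, forall K N, \sum_(0 <= k < K) ((h N)`_k)%R%:R * r ^+ k <= B.
  move=> /andP[r0 r1].
  have /hG hr : `|r%:C| < 1 :> R[i] by rewrite norm_real_complex ltcR ger0_norm.
  have [g _ Gg] := norm_real (G r%:C); exists (g + 1) => K N.
  have /tendsP/(_ 1 ltr01)[N0 _ hN0] := hr.
  have hle : \sum_(0 <= k < K) ((h N)`_k)%R%:R * r ^+ k <=
      \sum_(0 <= k < K) ((h (maxn N N0))`_k)%R%:R * r ^+ k.
    apply: ler_sum => k _; apply: ler_wpM2r; first exact: exprn_ge0.
    by rewrite ler_nat; apply: hm; exact: leq_maxl.
  apply: le_trans hle _; rewrite -lecR.
  apply: le_trans (nat_eval_ge _ _ r0) _.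
  have := hN0 (maxn N N0) (leq_maxr _ _); set y := nat_eval _ _ => /= hy.
  have y0 : 0 <= y by apply: le_trans (nat_eval_ge _ 0 r0); rewrite big_geq.
  rewrite -(ger0_norm y0) -[y](subrK (G r%:C)) rmorphD addrC.
  apply: le_trans (ler_normD _ _) _; rewrite Gg lerD2l distrC.
  exact: ltW.
have stat k : exists s, (forall N, ((h N)`_k)%R <= s)%N /\
    exists N0, forall N, (N0 <= N)%N -> (h N)`_k = s.
  have [|B hB] := bnd (2^-1); first by rewrite invr_ge0 ler0n invf_lt1 ?ltr1n ?ltr0n.
  apply: (bounded_nat_stationary (M := Num.bound (B * 2 ^+ k))).
    by move=> m n mn; exact: hm.
  move=> N; rewrite -(ler_nat R); apply: ltW.
  have hk : ((h N)`_k)%R%:R <= B * 2 ^+ k.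
    rewrite -ler_pdivrMr ?exprn_gt0// -exprVn.
    apply: le_trans (hB k.+1 N); rewrite big_nat_recr//= lerDr.
    by apply: sumr_ge0 => i _; rewrite mulr_ge0// exprn_ge0// invr_ge0.
  by apply: (le_lt_trans hk); apply: archi_boundP; apply: (le_trans _ hk).
have [S hS] := choice stat; exists S => q q1.
have [r r01 qr] := norm_lt1 q1; have [r0 r1] := andP r01.
have [B hB] := bnd r r01.
have [||k||L hL1 hL2] := @tannery R nat \oo _
    (fun N k => ((h N)`_k)%R%:R * q ^+ k) (fun N => nat_eval q (h N))
    (fun k => (S k)%:R * r ^+ k) (fun k => (S k)%:R * q ^+ k).
- apply: nondecreasing_is_cvgn.
    apply/nondecreasing_seqP => n; rewrite -subr_ge0 seriesSB.
    by rewrite mulr_ge0// exprn_ge0.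
  exists B => _ [K _ <-].
  have [N0 hN0] : exists N0, forall N, (N0 <= N)%N -> forall k, (k < K)%N ->
      (h N)`_k = S k.
    elim: K => [|K [N0 IH]]; first by exists 0.
    have [_ [N1 hN1]] := hS K; exists (maxn N0 N1) => N; rewrite geq_max => /andP[a b] k.
    by rewrite ltnS leq_eqVlt => /orP[/eqP ->|]; [exact: hN1|exact: IH].
  apply: le_trans (hB K N0); rewrite /series /= !big_nat.
  by apply: ler_sum => k /andP[_ kK]; rewrite hN0.
- apply: nearW => N k; rewrite normrM normrX qr rmorphM rmorph_nat rmorphXn.
  apply: ler_wpM2r; first by rewrite exprn_ge0// ler0c.
  by rewrite normr_nat ler_nat; case: (hS k).
- have [_ [N0 hN0]] := hS k; apply: (tends_near _ (tends_cst _)).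
  by exists N0 => // N /= NN0; rewrite hN0.
- by apply: nearW => N; exact: sums_nat_eval.
by rewrite (tends_unique (hG q q1) hL2).
Qed.

End CountingSequence.

Section SchurOverpartitions.
Variable R : realType.
Implicit Types (q x : R[i]).

Definition odd_factor q j : R[i] := (1 + q ^+ (2 * j).+1) / (1 - q ^+ (2 * j).+1).
Definition odd_ratio q : R[i] := qp (- q) (q ^+ 2) / qp q (q ^+ 2).

Lemma sub1_expr_neq0 q n : `|q| < 1 -> 1 - q ^+ n.+1 != 0.
Proof.
move=> q1; have := norm_expr_lt1 (isT : 0 < n.+1)%N q1.
by apply: contraTneq => /subr0_eq <-; rewrite normr1 ltxx.
Qed.

Lemma add1_expr_neq0 q n : `|q| < 1 -> 1 + q ^+ n.+1 != 0.
Proof.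
move=> q1; have := norm_expr_lt1 (isT : 0 < n.+1)%N q1.
by apply: contraTneq => /eqP; rewrite addrC addr_eq0 => /eqP ->; rewrite normrN normr1 ltxx.
Qed.

Lemma odd_ratio_neq0 q : `|q| < 1 -> odd_ratio q != 0.
Proof.
move=> q1; have q21 := norm_expr_lt1 (isT : 0 < 2)%N q1.
by rewrite mulf_neq0 ?invr_eq0 ?qp_neq0// normrN.
Qed.

Lemma has_prod_odd_ratio q : `|q| < 1 -> has_prod (odd_factor q) (odd_ratio q).
Proof.
move=> q1; have q21 := norm_expr_lt1 (isT : 0 < 2)%N q1.
have n0 : qp q (q ^+ 2) != 0 by exact: qp_neq0.
apply: tends_ext (has_prodM (qpP (- q) q21) (has_prodV n0 (qpP q q21))) => n.
by apply: eq_bigr => j _; rewrite /odd_factor mulNr opprK -!exprM -!exprS.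
Qed.

Lemma schur9_productE q : `|q| < 1 ->
  schur9_product q = odd_ratio q / odd_ratio (q ^+ 9).
Proof.
move=> q1; have q91 := norm_expr_lt1 (isT : 0 < 9)%N q1.
apply: infprodE.
apply: tends_ext (has_prodM (has_prod_odd_ratio q1)
  (has_prodV (odd_ratio_neq0 q91) (has_prod_odd_ratio q91))) => n.
apply: eq_bigr => j _; have -> : (2 * j.+1 - 1 = (2 * j).+1)%N by lia.
rewrite /odd_factor (exprM q 9) !invfM invrK.
by rewrite mulrACA [RHS]mulrACA; congr (_ * _); rewrite mulrC.
Qed.

Lemma prod_skip_ninth (u : nat -> R[i]) n :
  (\prod_(0 <= j < 9 * n) if (j %% 9 == 4)%N then 1 else u j) *
  \prod_(0 <= i < n) u (9 * i + 4)%N = \prod_(0 <= j < 9 * n) u j.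
Proof.
elim: n => [|n IH]; first by rewrite muln0 !big_geq// mulr1.
have -> : (9 * n.+1 = (9 * n).+4.+4.+1)%N by lia.
rewrite !(@big_nat_recr _ _ _ (9 * n).+4.+4)//= !(@big_nat_recr _ _ _ (9 * n).+4.+3)//=.
rewrite !(@big_nat_recr _ _ _ (9 * n).+4.+2)//= !(@big_nat_recr _ _ _ (9 * n).+4.+1)//=.
rewrite !(@big_nat_recr _ _ _ (9 * n).+4)//= !(@big_nat_recr _ _ _ (9 * n).+3)//=.
rewrite !(@big_nat_recr _ _ _ (9 * n).+2)//= !(@big_nat_recr _ _ _ (9 * n).+1)//=.
rewrite !(@big_nat_recr _ _ _ (9 * n))//= (@big_nat_recr _ _ _ n)//= -IH.
have m9 k : (k < 9)%N -> ((9 * n + k) %% 9 = k)%N.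
  by move=> k9; rewrite mulnC modnMDl modn_small.
have e0 := m9 0%N isT; have e1 := m9 1%N isT; have e2 := m9 2%N isT.
have e3 := m9 3%N isT; have e4 := m9 4%N isT; have e5 := m9 5%N isT.
have e6 := m9 6%N isT; have e7 := m9 7%N isT; have e8 := m9 8%N isT.
rewrite !addnS addn0 in e0 e1 e2 e3 e4 e5 e6 e7 e8.
rewrite e0 e1 e2 e3 e4 e5 e6 e7 e8 /= !addnS addn0.
ring.
Qed.

Lemma nat_evalM q (p h : {poly nat}) : nat_eval q (p * h) = nat_eval q p * nat_eval q h.
Proof. by rewrite /nat_eval rmorphM hornerM. Qed.

Lemma nat_evalXn q n : nat_eval q 'X^n = q ^+ n.
Proof. by rewrite /nat_eval map_polyXn hornerXn. Qed.

Lemma nat_eval1 q : nat_eval q 1 = 1.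
Proof. by rewrite /nat_eval rmorph1 hornerC. Qed.

Lemma nat_eval_prod q (u : nat -> {poly nat}) n :
  nat_eval q (\prod_(0 <= j < n) u j) = \prod_(0 <= j < n) nat_eval q (u j).
Proof.
elim: n => [|n IH]; first by rewrite !big_geq// nat_eval1.
by rewrite !big_nat_recr//= nat_evalM IH.
Qed.

Lemma nat_eval_sum q (u : nat -> {poly nat}) n :
  nat_eval q (\sum_(0 <= j < n) u j) = \sum_(0 <= j < n) nat_eval q (u j).
Proof. by rewrite /nat_eval rmorph_sum horner_sum. Qed.

Definition schur_factor N j : {poly nat} :=
  if (j %% 9 == 4)%N then 1
  else (1 + 'X^((2 * j).+1)) * \sum_(0 <= i < N) 'X^((2 * j).+1 * i).

(* The factors of index [j = 4 mod 9] are those cancelled by the factors in q^9. *)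
Definition schur_poly N := \prod_(0 <= j < 9 * N) schur_factor N j.

Lemma schur_factor_le N M j : (N <= M)%N -> poly_le (schur_factor N j) (schur_factor M j).
Proof.
move=> NM; rewrite /schur_factor; case: ifP => _; first by move=> k.
apply: poly_leM => k; first by [].
rewrite (@big_cat_nat _ _ _ N 0 M)//= coefD; exact: leq_addr.
Qed.

Lemma schur_factor_ge1 N j : (0 < N)%N -> poly_le 1 (schur_factor N j).
Proof.
move=> N0; rewrite /schur_factor; case: ifP => _; first by move=> k.
rewrite -{1}[1]mulr1.
apply: poly_leM => k; first by rewrite coefD; exact: leq_addr.
by rewrite big_ltn// muln0 expr0 coefD; exact: leq_addr.
Qed.

Lemma schur_poly_le N M : (N <= M)%N -> poly_le (schur_poly N) (schur_poly M).
Proof.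
move=> NM k; have [M0|M0] := posnP M.
  by have -> : N = M by lia.
apply: (@leq_trans ((\prod_(0 <= j < 9 * N) schur_factor M j)`_k)%R).
  by apply: poly_le_prod => j; exact: schur_factor_le.
apply: poly_le_prod_widen => [|j]; first lia.
exact: schur_factor_ge1.
Qed.

Lemma nat_eval_schur_factor q N j : `|q| < 1 ->
  nat_eval q (schur_factor N j) =
  (if (j %% 9 == 4)%N then 1 else odd_factor q j) *
  (if (j %% 9 == 4)%N then 1 else 1 - (q ^+ (2 * j).+1) ^+ N).
Proof.
move=> q1; rewrite /schur_factor; case: ifP => _; first by rewrite nat_eval1 mulr1.
have n0 := @sub1_expr_neq0 q (2 * j) q1.
rewrite nat_evalM nat_eval_sum /odd_factor -mulrA; congr (_ * _).
  by rewrite /nat_eval rmorphD hornerD -/(nat_eval q 1) -/(nat_eval q 'X^_) nat_eval1 nat_evalXn.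
apply: (mulfI n0); rewrite [RHS]mulrA divff// mul1r.
apply: oppr_inj; rewrite -mulNr !opprB (subrX1 (q ^+ (2 * j).+1) N) big_mkord; congr (_ * _).
by apply: eq_bigr => i _; rewrite nat_evalXn exprM.
Qed.

Lemma truncation_tends q : `|q| < 1 ->
  tends \oo (fun N => \prod_(0 <= j < 9 * N)
     (if (j %% 9 == 4)%N then 1 else 1 - (q ^+ (2 * j).+1) ^+ N)) 1.
Proof.
move=> q1; have [r r01 qr] := norm_lt1 q1; have [r0 r1] := andP r01.
pose v N j := if (9 * N <= j)%N || (j %% 9 == 4)%N then 1 else 1 - (q ^+ (2 * j).+1) ^+ N.
have expq m : (0 < m)%N -> tends \oo (fun N => q ^+ (m * N)) 0.
  move=> m0; apply/tendsP => e e0.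
  have /cvgrPdist_lt/(_ e e0) : (GRing.exp r) @ \oo --> (0 : R).
    by apply: cvg_expr; rewrite ger0_norm.
  apply: filterS => N; rewrite !sub0r !normrN => h.
  rewrite normrX qr -rmorphXn ltcR; apply: le_lt_trans h.
  by rewrite normrX ger0_norm//; apply: ler_wiXn2l => //; [exact: ltW|nia].
have [||j|N|L hL1 hL2] := @tannery_prod R nat \oo _ v
  (fun N => \prod_(0 <= j < 9 * N) v N j) (fun j => 1 * r ^+ j) (fun=> 1).
- exact: geometric_cvg.
- move=> N j; rewrite /v mul1r; case: ifP => [_|/negbT].
    by rewrite subrr normr0 ler0c exprn_ge0.
  rewrite negb_or -ltnNge => /andP[jN _].
  rewrite addrC addKr normrN -exprM normrX qr -rmorphXn lecR.
  apply: ler_wiXn2l => //; first exact: ltW.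
  have N0 : (0 < N)%N by lia.
  by have := leq_pmulr (2 * j).+1 N0; lia.
- case: (boolP (j %% 9 == 4)%N) => hj.
    by apply: tends_ext (tends_cst 1) => N; rewrite /v hj orbT.
  rewrite -[X in tends _ _ X]subr0.
  apply: (tends_near _ (tendsB (tends_cst 1) (expq (2 * j).+1 isT))); exists j.+1 => // N /= jN.
  rewrite /v (negbTE hj) orbF ifN ?exprM//; lia.
- apply: (tends_near _ (tends_cst _)); exists (9 * N)%N => // n /= nN.
  rewrite [RHS](@big_cat_nat _ _ _ (9 * N))//=.
  rewrite [X in _ * X]big_nat_cond [X in _ * X]big1 ?mulr1// => k /andP[/andP[h _] _].
  by rewrite /v h.
have L1 : L = 1.
  apply: has_prod_unique hL1 _; apply: tends_ext (tends_cst 1) => n.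
  by rewrite big1.
rewrite L1 in hL2.
apply: tends_ext hL2 => N; apply: eq_big_nat => j /andP[_ jN].
by rewrite /v leqNgt jN.
Qed.

Lemma schur_poly_tends q : `|q| < 1 ->
  tends \oo (fun N => nat_eval q (schur_poly N)) (schur9_product q).
Proof.
move=> q1; have q91 := norm_expr_lt1 (isT : 0 < 9)%N q1.
have h1 : tends \oo ((fun n => \prod_(0 <= j < n) odd_factor q j) \o muln 9) (odd_ratio q).
  by apply: (tends_comp (k := 0) _ (has_prod_odd_ratio q1)) => n; lia.
have h2 := has_prod_odd_ratio q91.
rewrite schur9_productE// -[odd_ratio q / _]mulr1.
apply: tends_ext (tendsM (tendsM h1 (tendsV (odd_ratio_neq0 q91) h2))
  (truncation_tends q1)) => N.
rewrite /schur_poly nat_eval_prod; under [RHS]eq_bigr do rewrite nat_eval_schur_factor//.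
rewrite [RHS]big_split /=; congr (_ * _).
rewrite -prod_skip_ninth.
have -> : \prod_(0 <= i < N) odd_factor q (9 * i + 4) =
          \prod_(0 <= i < N) odd_factor (q ^+ 9) i.
  apply: eq_bigr => i _; rewrite /odd_factor -exprM.
  by have -> : ((2 * (9 * i + 4)).+1 = 9 * (2 * i).+1)%N by lia.
rewrite mulfK//; elim: N => [|N IH]; first by rewrite big_geq// oner_neq0.
rewrite big_nat_recr//= mulf_neq0//.
by rewrite /odd_factor mulf_neq0 ?invr_eq0 ?add1_expr_neq0 ?sub1_expr_neq0.
Qed.

Theorem S9bar_counting : is_schur9_counting R (S9bar R).
Proof.
have [S hS] := counting_sequence_exists (@schur_poly_le) schur_poly_tends.
apply: (@getPex _ [set S | is_schur9_counting R S]); exists S => q q1.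
by apply/has_sumP; exact: hS.
Qed.

Lemma schur9_product_f q : `|q| < 1 -> schur9_product q =
  f_ 2 q ^+ 3 * f_ 9 q ^+ 2 * f_ 36 q / (f_ 1 q ^+ 2 * f_ 4 q * f_ 18 q ^+ 3).
Proof.
move=> q1; have q91 := norm_expr_lt1 (isT : 0 < 9)%N q1.
have nz k (k0 : (0 < k)%N) := f_neq0 k0 q1.
rewrite schur9_productE// /odd_ratio !qp_odd// !qpN_odd//.
have -> : f_ 1 (q ^+ 9) = f_ 9 q by exact: f_exprM.
have -> : f_ 2 (q ^+ 9) = f_ 18 q by exact: f_exprM.
have -> : f_ 4 (q ^+ 9) = f_ 36 q by exact: f_exprM.
by field; rewrite !nz.
Qed.

End SchurOverpartitions.

Section OddFilter.
Variable F : fieldType.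
Implicit Types w x z : F.

Lemma cube_root_sum w n : w ^+ 2 + w + 1 = 0 ->
  1 + w ^+ n + w ^+ (2 * n) = if (3 %| n)%N then 3 else 0.
Proof.
move=> w0; have w3 := cube_root1_expr w0.
have [m [s [s3 nE]]] : exists m s, (s < 3)%N /\ n = (3 * m + s)%N.
  by exists (n %/ 3)%N, (n %% 3)%N; split; [lia|lia].
have we k : w ^+ (3 * k) = 1 by rewrite exprM w3 expr1n.
have -> : w ^+ n = w ^+ s by rewrite nE exprD we mul1r.
have -> : w ^+ (2 * n) = w ^+ (2 * s).
  have -> : (2 * n = 3 * (2 * m) + 2 * s)%N by lia.
  by rewrite exprD we mul1r.
have -> : (3 %| n)%N = (s == 0)%N by apply/idP/eqP; lia.
case: s s3 {nE} => [|[|[|//]]] _ /=; first by rewrite muln0 expr0; ring.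
  by rewrite muln1 -w0; ring.
have -> : w ^+ (2 * 2) = w by rewrite -[RHS]mul1r -w3; ring.
by rewrite -w0; ring.
Qed.

(* [w ^+ (2 * r)] and [w ^+ (4 * r)] are w^(-r) and w^(-2r): for odd [r], this is
   six times the projection onto the exponents congruent to [r] mod 6. *)
Definition odd_filter w r (X : F -> F) z :=
  (X z - X (- z)) + w ^+ (2 * r) * (X (w * z) - X (- (w * z))) +
  w ^+ (4 * r) * (X (w ^+ 2 * z) - X (- (w ^+ 2 * z))).

Lemma odd_filter_expr w r z n : w ^+ 2 + w + 1 = 0 -> odd r -> (r < 6)%N ->
  odd_filter w r (fun x => x ^+ n) z = if (n %% 6 == r)%N then 6 * z ^+ n else 0.
Proof.
move=> w0 ro r6.
have -> : odd_filter w r (fun x => x ^+ n) z = (1 - (-1) ^+ n) *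
    (1 + w ^+ (n + 2 * r) + w ^+ (2 * (n + 2 * r))) * z ^+ n.
  rewrite /odd_filter (exprNn z) (exprNn (w * z)) (exprNn (w ^+ 2 * z)) !exprMn.
  have -> : (2 * (n + 2 * r) = n + n + 4 * r)%N by lia.
  rewrite !exprD.
  ring.
rewrite (cube_root_sum _ w0) -signr_odd.
case: (boolP (odd n)) => no; last first.
  rewrite expr0 subrr !mul0r ifN//; apply/eqP; lia.
have -> : (n %% 6 == r)%N = (3 %| n + 2 * r)%N by apply/idP/idP; lia.
case: ifP => _; [rewrite expr1; ring|by rewrite mulr0 mul0r].
Qed.

Lemma odd_filter_sum w r (a : nat -> F) (p : nat -> F -> F) z N :
  odd_filter w r (fun x => \sum_(0 <= n < N) a n * p n x) z =
  \sum_(0 <= n < N) a n * odd_filter w r (p n) z.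
Proof.
rewrite /odd_filter; elim: N => [|N IH]; first by rewrite !big_geq//; ring.
rewrite !big_nat_recr//= -IH; ring.
Qed.

End OddFilter.

Section SixSection.
Variable R : realType.
Implicit Types (q x z w : R[i]).

Lemma sum_residue6 (g : nat -> R[i]) r N : (r < 6)%N ->
  \sum_(0 <= n < 6 * N) (if (n %% 6 == r)%N then g n else 0) =
  \sum_(0 <= n < N) g (6 * n + r)%N.
Proof.
move=> r6; elim: N => [|N IH]; first by rewrite muln0 !big_geq.
have -> : (6 * N.+1 = (6 * N).+4.+2)%N by lia.
rewrite !(@big_nat_recr _ _ _ (6 * N).+4.+1)//= !(@big_nat_recr _ _ _ (6 * N).+4)//=.
rewrite !(@big_nat_recr _ _ _ (6 * N).+3)//= !(@big_nat_recr _ _ _ (6 * N).+2)//=.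
rewrite !(@big_nat_recr _ _ _ (6 * N).+1)//= !(@big_nat_recr _ _ _ (6 * N))//=.
rewrite (@big_nat_recr _ _ _ N)//= IH.
have m6 k : (k < 6)%N -> ((6 * N + k) %% 6 = k)%N.
  by move=> k6; rewrite mulnC modnMDl modn_small.
have e0 := m6 0%N isT; have e1 := m6 1%N isT; have e2 := m6 2%N isT.
have e3 := m6 3%N isT; have e4 := m6 4%N isT; have e5 := m6 5%N isT.
rewrite !addnS addn0 in e0 e1 e2 e3 e4 e5.
rewrite e0 e1 e2 e3 e4 e5.
by case: r r6 {m6 IH} => [|[|[|[|[|[|//]]]]]] _ /=;
  rewrite ?addnS addn0 ?addr0.
Qed.

Lemma odd_filter_sums w r (a : nat -> R[i]) (G : R[i] -> R[i]) z :
  w ^+ 2 + w + 1 = 0 -> odd r -> (r < 6)%N -> z != 0 -> `|z| < 1 ->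
  (forall x, `|x| < 1 -> sums (fun n => a n * x ^+ n) (G x)) ->
  sums (fun n => a (6 * n + r)%N * (z ^+ 6) ^+ n) (odd_filter w r G z / (6 * z ^+ r)).
Proof.
move=> w0 ro r6 z0 z1 hG; have [w3 w1] := cube_root1 w0.
have z1' j : `|w ^+ j * z| < 1 by rewrite normrM normrX w1 expr1n mul1r.
have hw := z1' 1%N; rewrite expr1 in hw.
have part x : `|x| < 1 ->
    tends \oo (fun N => \sum_(0 <= n < 6 * N) a n * x ^+ n) (G x).
  by move=> x1; apply: (tends_comp (k := 0) _ (hG x x1)) => n; lia.
have partD x : `|x| < 1 -> tends \oo (fun N => \sum_(0 <= n < 6 * N) a n * x ^+ n -
    \sum_(0 <= n < 6 * N) a n * (- x) ^+ n) (G x - G (- x)).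
  by move=> x1; apply: tendsB; apply: part; rewrite ?normrN.
have h : tends \oo (fun N => odd_filter w r
    (fun x => \sum_(0 <= n < 6 * N) a n * x ^+ n) z) (odd_filter w r G z).
  apply: tendsD; first apply: tendsD; first exact: partD.
    by apply: tendsM; [exact: tends_cst|exact: partD].
  by apply: tendsM; [exact: tends_cst|exact: partD].
apply: tends_ext (tendsM h (tends_cst (6 * z ^+ r)^-1)) => N.
have n6 : 6 * z ^+ r != 0 by rewrite mulf_neq0 ?pnatr_eq0 ?expf_neq0.
apply: (mulIf n6); rewrite divfK// odd_filter_sum.
rewrite (eq_bigr (fun n => if (n %% 6 == r)%N then a n * (6 * z ^+ n) else 0)); last first.
  by move=> n _; rewrite odd_filter_expr//; case: ifP; rewrite ?mulr0.
rewrite sum_residue6// /series /= mulr_suml; apply: eq_bigr => n _.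
rewrite exprD exprM; ring.
Qed.

Lemma sums_at0 (c : nat -> nat) (V : R[i] -> R[i]) :
  (forall q, q != 0 -> `|q| < 1 -> sums (fun n => (c n)%:R * q ^+ n) (V q)) ->
  (forall y : nat -> R[i], (forall k, `|y k| <= (2^-1)%:C) -> tends \oo y 0 ->
     tends \oo (fun k => V (y k)) (V 0)) ->
  sums (fun n => (c n)%:R * 0 ^+ n) (V 0).
Proof.
move=> hV Vc; pose h : R := 2^-1; have h0 : 0 < h by rewrite invr_gt0 ltr0n.
have h1 : h < 1 by rewrite invf_lt1 ?ltr1n ?ltr0n.
pose y k : R[i] := (h * h ^+ k)%:C.
have yh k : `|y k| <= h%:C.
  rewrite norm_real_complex lecR ger0_norm; last by rewrite mulr_ge0 ?exprn_ge0 ?ltW.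
  by apply: ler_piMr; [exact: ltW|apply: exprn_ile1; exact: ltW].
have y0 : tends \oo y 0.
  by apply: tends_real; apply: (@cvg_geometric R h h); rewrite ger0_norm// ltW.
have yn k : y k != 0.
  by rewrite /y -[0]/(0%:C) (inj_eq (@complexI R)) mulf_neq0 ?expf_neq0 ?gt_eqF.
have hC1 : `|h%:C| < 1 :> R[i] by rewrite norm_real_complex ltcR ger0_norm ?ltW.
have hC0 : h%:C != 0 :> R[i] by rewrite -[0]/(0%:C) (inj_eq (@complexI R)) gt_eqF.
have [||n||L hL1 hL2] := @tannery R nat \oo _ (fun k n => (c n)%:R * y k ^+ n)
    (fun k => V (y k)) (fun n => (c n)%:R * h ^+ n) (fun n => (c n)%:R * 0 ^+ n).
- apply/cvg_ex; exists (complex.Re (V h%:C)).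
  apply: (cvg_trans _ (tends_Re (hV _ hC0 hC1))); apply: near_eq_cvg.
  apply: nearW => N; rewrite /series /=.
  have -> : \sum_(0 <= k < N) (c k)%:R * h%:C ^+ k =
      (\sum_(0 <= k < N) (c k)%:R * h ^+ k)%:C :> R[i].
    by rewrite rmorph_sum; apply: eq_bigr => k _; rewrite rmorphM rmorph_nat rmorphXn.
  by [].
- apply: nearW => k n; rewrite normrM normr_nat normrX rmorphM rmorph_nat rmorphXn.
  apply: ler_wpM2l; first exact: ler0n.
  by apply: lerXn2r; rewrite ?nnegrE// ler0c ltW.
- by apply: tendsM; [exact: tends_cst|exact: tendsX].
- apply: nearW => k; apply: hV => //; apply: le_lt_trans (yh k) _.
  by rewrite ltcR.
by rewrite -(tends_unique hL2 (Vc y yh y0)).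
Qed.

End SixSection.

Section MainComputation.
Variable R : realType.
Implicit Types (q x z w : R[i]).

Lemma cubic_defectE q : `|q| < 1 -> 1 - 8 * q / cubic_u q ^+ 3 =
  f_ 1 q ^+ 8 * f_ 6 q ^+ 4 / (f_ 2 q ^+ 4 * f_ 3 q ^+ 8).
Proof.
move=> q1; have nz k (k0 : (0 < k)%N) := f_neq0 k0 q1.
have n0 : (f_ 3 q ^+ 2 / f_ 6 q) ^+ 3 != 0.
  by rewrite expf_neq0// mulf_neq0 ?invr_eq0 ?expf_neq0 ?nz.
apply: (mulfI n0).
transitivity ((f_ 3 q ^+ 2 / f_ 6 q) ^+ 3 -
  8 * q * (f_ 1 q * f_ 6 q ^+ 2 / (f_ 2 q * f_ 3 q)) ^+ 3).
  by rewrite /cubic_u; field; rewrite !nz.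
by rewrite -phi_cube//; field; rewrite !nz.
Qed.

Lemma schur9_quotient (F : fieldType) (f1 f2 f4 f9 f18 f36 a b : F) :
  [&& f1 != 0, f2 != 0, f4 != 0, f9 != 0 & f18 != 0 ] -> f36 != 0 ->
  (f2 ^+ 3 / (f1 * f4)) ^+ 2 / f2 = (f18 ^+ 3 / (f9 * f36)) ^+ 2 / f18 * a ->
  f2 ^+ 2 / f4 = f18 ^+ 2 / f36 * b ->
  f2 ^+ 3 * f9 ^+ 2 * f36 / (f1 ^+ 2 * f4 * f18 ^+ 3) * b = a.
Proof.
move=> /and5P[n1 n2 n4 n9 n18] n36 ha hb.
have nA : (f18 ^+ 3 / (f9 * f36)) ^+ 2 / f18 != 0.
  by rewrite !mulf_neq0 ?invr_eq0 ?expf_neq0 ?mulf_neq0 ?invr_eq0 ?expf_neq0.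
have nB : f18 ^+ 2 / f36 != 0 by rewrite mulf_neq0 ?invr_eq0 ?expf_neq0.
have -> : b = f2 ^+ 2 / f4 / (f18 ^+ 2 / f36) by rewrite hb mulrC mulKf.
apply: (mulfI nA); rewrite -ha; field.
by rewrite n1 n2 n4 n9 n18 n36.
Qed.

Lemma cubic_rationalize (F : fieldType) (G a z w : F) : w != 0 ->
  G * (1 - 2 * z ^+ 2 / w) = a ->
  G * (1 - 8 * z ^+ 6 / w ^+ 3) = a * (1 + 2 * z ^+ 2 / w + 4 * z ^+ 4 / w ^+ 2).
Proof. by move=> w0 <-; field. Qed.

Lemma schur9_cubic_u z : `|z| < 1 ->
  schur9_product z * (1 - 8 * z ^+ 6 / cubic_u (z ^+ 6) ^+ 3) =
  (1 + 2 * z / cubic_u (- z ^+ 3)) *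
  (1 + 2 * z ^+ 2 / cubic_u (z ^+ 6) + 4 * z ^+ 4 / cubic_u (z ^+ 6) ^+ 2).
Proof.
move=> z1; have nz k (k0 : (0 < k)%N) := f_neq0 k0 z1.
have w0 : cubic_u (z ^+ 6) != 0 by rewrite cubic_u_neq0// norm_expr_lt1.
apply: (cubic_rationalize w0); rewrite (schur9_product_f z1).
apply: (schur9_quotient _ (nz 36%N isT) (phiN_cubic_u z1) (phi_sqr_cubic_u z1)).
by apply/and5P; split; exact: nz.
Qed.

Lemma odd_part_identity (F : fieldType) (X Y E x a u v w : F) :
  [&& u != 0, v != 0, w != 0 & E != 0] ->
  X * E = (1 + 2 * x / v) * (1 + 2 * x ^+ 2 / w + 4 * x ^+ 4 / w ^+ 2) ->
  Y * E = (1 - 2 * x / u) * (1 + 2 * x ^+ 2 / w + 4 * x ^+ 4 / w ^+ 2) ->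
  u * v = w -> u + v = 2 * a ->
  X - Y = 4 * a / (w * E) * (x + 2 / w * x ^+ 3 + 4 / w ^+ 2 * x ^+ 5).
Proof.
move=> /and4P[u0 v0 w0 E0] hX hY uv uDv.
apply: (mulIf E0); rewrite mulrBl hX hY.
have -> : 4 * a = 2 * (u + v) by rewrite uDv; ring.
by rewrite -uv; field; rewrite u0 v0 E0.
Qed.

Lemma odd_filter_cubic (F : fieldType) (w z c b : F) m (X : F -> F) :
  w ^+ 2 + w + 1 = 0 -> (m < 3)%N ->
  (forall j, X (w ^+ j * z) - X (- (w ^+ j * z)) = c *
    (w ^+ j * z + b * (w ^+ j * z) ^+ 3 + b ^+ 2 * (w ^+ j * z) ^+ 5)) ->
  odd_filter w (2 * m).+1 X z = 3 * c * b ^+ m * z ^+ (2 * m).+1.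
Proof.
move=> w0 m3 hX; set r := (2 * m).+1.
have h0 := hX 0%N; have h1 := hX 1%N; have h2 := hX 2%N.
rewrite expr0 mul1r in h0; rewrite expr1 in h1.
rewrite /odd_filter h0 h1 h2.
transitivity (c * (z * (1 + w ^+ (1 + 2 * r) + w ^+ (2 * (1 + 2 * r))) +
  b * z ^+ 3 * (1 + w ^+ (3 + 2 * r) + w ^+ (2 * (3 + 2 * r))) +
  b ^+ 2 * z ^+ 5 * (1 + w ^+ (5 + 2 * r) + w ^+ (2 * (5 + 2 * r))))).
  have e k : (2 * (k + 2 * r) = 2 * k + 4 * r)%N by lia.
  rewrite !e !exprD; ring.
rewrite !cube_root_sum// /r; case: m m3 {r h0 h1 h2} => [|[|[|//]]] _ /=; ring.
Qed.

Definition section_value m q : R[i] := 2 * half_sum q * (2 / cubic_u q) ^+ m /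
  (cubic_u q * (1 - 8 * q / cubic_u q ^+ 3)).

Lemma schur_section_nonzero m q : (m < 3)%N -> q != 0 -> `|q| < 1 ->
  sums (fun n => (S9bar R (6 * n + (2 * m).+1))%:R * q ^+ n) (section_value m q).
Proof.
move=> m3 q0 q1; have [z zq z1] := root_exists (isT : 0 < 6)%N q1.
have [w w0] := cube_root1_exists R; have [w3 w1] := cube_root1 w0.
have z0 : z != 0 by apply: contra_neq q0 => z0; rewrite -zq z0 expr0n.
have nz k (k0 : (0 < k)%N) := f_neq0 k0 q1.
have Q1 : `|z ^+ 3| < 1 by rewrite norm_expr_lt1.
have W0 := cubic_u_neq0 q1.
have E0 : 1 - 8 * q / cubic_u q ^+ 3 != 0.
  by rewrite cubic_defectE// !mulf_neq0 ?invr_eq0 ?mulf_neq0 ?expf_neq0 ?nz.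
have zq' : (z ^+ 3) ^+ 2 = q by rewrite -exprM.
have uv := cubic_uM Q1; have uDv := cubic_uD Q1; rewrite zq' in uv uDv.
have hX j : schur9_product (w ^+ j * z) - schur9_product (- (w ^+ j * z)) =
    4 * half_sum q / (cubic_u q * (1 - 8 * q / cubic_u q ^+ 3)) *
    (w ^+ j * z + 2 / cubic_u q * (w ^+ j * z) ^+ 3 +
     (2 / cubic_u q) ^+ 2 * (w ^+ j * z) ^+ 5).
  set x := w ^+ j * z.
  have x1 : `|x| < 1 by rewrite normrM normrX w1 expr1n mul1r.
  have xN1 : `|- x| < 1 by rewrite normrN.
  have wj k : (w ^+ j) ^+ (3 * k) = 1 by rewrite exprAC exprM w3 !expr1n.
  have x3 : x ^+ 3 = z ^+ 3 by rewrite exprMn (wj 1%N) mul1r.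
  have x6 : x ^+ 6 = q by rewrite exprMn (wj 2%N) mul1r.
  have hp := schur9_cubic_u x1; have hn := schur9_cubic_u xN1.
  rewrite x3 x6 in hp.
  have xN3 : - (- x) ^+ 3 = z ^+ 3 by rewrite -x3; ring.
  have xN6 : (- x) ^+ 6 = q by rewrite -x6; ring.
  have xN2 : (- x) ^+ 2 = x ^+ 2 by ring.
  have xN4 : (- x) ^+ 4 = x ^+ 4 by ring.
  rewrite xN3 xN6 xN2 xN4 mulrN mulNr in hn.
  have -> : (2 / cubic_u q) ^+ 2 = 4 / cubic_u q ^+ 2.
    by rewrite expr_div_n -natrX.
  apply: odd_part_identity hp hn uv uDv.
  have QN1 : `|- z ^+ 3| < 1 by rewrite normrN.
  by apply/and4P; exact: And4 (cubic_u_neq0 Q1) (cubic_u_neq0 QN1) W0 E0.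
have hS x (x1 : `|x| < 1) : sums (fun n => (S9bar R n)%:R * x ^+ n) (schur9_product x).
  by apply/has_sumP; exact: S9bar_counting.
have r6 : ((2 * m).+1 < 6)%N by case: m m3 {hX} => [|[|[|]]].
have ro : odd (2 * m).+1 by rewrite /= oddM.
have := odd_filter_sums w0 ro r6 z0 z1 hS.
rewrite (odd_filter_cubic w0 m3 hX) zq.
have -> // : 3 * (4 * half_sum q / (cubic_u q * (1 - 8 * q / cubic_u q ^+ 3))) *
  (2 / cubic_u q) ^+ m * z ^+ (2 * m).+1 / (6 * z ^+ (2 * m).+1) = section_value m q.
rewrite /section_value.
have zr0 : z ^+ (2 * m).+1 != 0 by rewrite expf_neq0.
have n6 : 6 != 0 :> R[i] by rewrite pnatr_eq0.
move: (cubic_u q * _) (half_sum q) (_ ^+ m) (z ^+ _) zr0 => D a B Z Z0.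
rewrite -mulf_div (divff Z0) mulr1.
have -> : 3 * (4 * a / D) * B = 2 * a * B / D * 6 by ring.
by rewrite mulfK.
Qed.

Lemma section_value_tends m (y : nat -> R[i]) : (forall k, `|y k| <= (2^-1)%:C) ->
  tends \oo y 0 -> tends \oo (fun k => section_value m (y k)) (section_value m 0).
Proof.
move=> yb y0; have r01 : 0 <= (2^-1 : R) < 1.
  by rewrite invr_ge0 ler0n invf_lt1 ?ltr1n ?ltr0n.
have hu : tends \oo (fun k => cubic_u (y k)) (cubic_u 0).
  exact: (cubic_u_tends r01 yb y0).
have ha : tends \oo (fun k => half_sum (y k)) (half_sum 0).
  exact: (half_sum_tends r01 yb y0).
have n0 : `|0 : R[i]| < 1 by rewrite normr0 ltr01.
have nz k (k0 : (0 < k)%N) := @f_neq0 R k 0 k0 n0.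
have W0 := cubic_u_neq0 n0.
have E0 : 1 - 8 * 0 / cubic_u 0 ^+ 3 != 0 :> R[i].
  by rewrite mulr0 mul0r subr0 oner_neq0.
apply: tendsM.
  apply: tendsM; first by apply: tendsM; [exact: tends_cst|exact: ha].
  apply: tendsX; apply: tendsM; first exact: tends_cst.
  exact: (tendsV W0 hu).
apply: tendsV; first exact: mulf_neq0.
apply: tendsM; first exact: hu.
apply: tendsB; first exact: tends_cst.
apply: tendsM; first by apply: tendsM; [exact: tends_cst|exact: y0].
apply: tendsV; first exact: expf_neq0.
exact: (tendsX 3 hu).
Qed.

Lemma schur_section m q : (m < 3)%N -> `|q| < 1 ->
  sums (fun n => (S9bar R (6 * n + (2 * m).+1))%:R * q ^+ n) (section_value m q).
Proof.
move=> m3 q1; have [->|q0] := eqVneq q 0; last exact: schur_section_nonzero.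
apply: (sums_at0 (c := fun n => S9bar R (6 * n + (2 * m).+1))).
  by move=> x x0 x1; exact: schur_section_nonzero.
by move=> y yb y0; exact: section_value_tends.
Qed.

Lemma section_valueE m q : `|q| < 1 -> section_value m q =
  2 * (2 * (f_ 1 q * f_ 6 q ^+ 3) / (f_ 2 q * f_ 3 q ^+ 3)) ^+ m *
  (f_ 2 q ^+ 6 * f_ 3 q ^+ 4 / (f_ 1 q ^+ 8 * f_ 6 q ^+ 2)).
Proof.
move=> q1; have nz k (k0 : (0 < k)%N) := f_neq0 k0 q1.
rewrite /section_value cubic_defectE//.
have -> : 2 / cubic_u q = 2 * (f_ 1 q * f_ 6 q ^+ 3) / (f_ 2 q * f_ 3 q ^+ 3).
  by rewrite /cubic_u; field; rewrite !nz.
rewrite /cubic_u /half_sum; move: (_ ^+ m) => B.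
by field; rewrite !nz.
Qed.

End MainComputation.

Theorem theorem3p2 (R : realType) (q : R[i]) (hq : `|q| < 1) :
  [/\ has_sum (fun n => (S9bar R (6 * n + 1))%:R * q ^+ n)
        (2 * (f_ 2 q ^+ 6 * f_ 3 q ^+ 4) / (f_ 1 q ^+ 8 * f_ 6 q ^+ 2)),
      has_sum (fun n => (S9bar R (6 * n + 3))%:R * q ^+ n)
        (4 * (f_ 2 q ^+ 5 * f_ 3 q * f_ 6 q) / f_ 1 q ^+ 7)
    & has_sum (fun n => (S9bar R (6 * n + 5))%:R * q ^+ n)
        (8 * (f_ 2 q ^+ 4 * f_ 6 q ^+ 4) / (f_ 1 q ^+ 6 * f_ 3 q ^+ 2))].
Proof.
have nz k (k0 : (0 < k)%N) := f_neq0 k0 hq.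
have e1 : 2 * (f_ 2 q ^+ 6 * f_ 3 q ^+ 4) / (f_ 1 q ^+ 8 * f_ 6 q ^+ 2) = section_value 0 q.
  by rewrite section_valueE//; field; rewrite !nz.
have e3 : 4 * (f_ 2 q ^+ 5 * f_ 3 q * f_ 6 q) / f_ 1 q ^+ 7 = section_value 1 q.
  by rewrite section_valueE//; field; rewrite !nz.
have e5 : 8 * (f_ 2 q ^+ 4 * f_ 6 q ^+ 4) / (f_ 1 q ^+ 6 * f_ 3 q ^+ 2) = section_value 2 q.
  by rewrite section_valueE//; field; rewrite !nz.
split; apply/has_sumP; rewrite ?e1 ?e3 ?e5.
- exact: (@schur_section R 0 q isT hq).
- exact: (@schur_section R 1 q isT hq).
- exact: (@schur_section R 2 q isT hq).
Qed.
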